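(* Let $X$ be a CB process with branching mechanism $\Phi$ given by $(\alpha,\beta,\pi)$, with $\pi\neq0$, and let $x>0$. For any $t\in(0,\infty)$, the restriction to $(0,\infty)$ of the distribution of $\sup_{s\in(0,t]}\Delta X_s$ under $\mathbf{P}_x$ and the Lévy measure $\pi$ are absolutely continuous with respect to each other.
   Context: A branching mechanism is a function $\Phi(\lambda)=\alpha\lambda+\beta\lambda^2+\int_{(0,\infty)}(e^{-\lambda\theta}-1+\lambda\theta)\,\pi(d\theta)$, $\lambda\ge0$, with $\alpha\in\mathbb{R}$, $\beta\ge0$ and $\pi$ a $\sigma$-finite measure on $(0,\infty)$ (the Lévy measure) with $\int_{(0,\infty)}(\theta\wedge\theta^2)\,\pi(d\theta)<\infty$; the case $\Phi\equiv0$ is excluded. A CB process with branching mechanism $\Phi$ is an rcll $[0,\infty)$-valued Markov process $X=(X_t)_{t\ge0}$ such that, writing $\mathbf{P}_x$ for its law when $X_0=x$ and $\mathbf{E}_x$ for the expectation, $\mathbf{E}_x[e^{-\lambda X_t}]=e^{-xv_t(\lambda)}$ for $\lambda\ge0$, where $v_t(\lambda)$ is the unique locally bounded nonnegative solution of $v_t(\lambda)=\lambda-\int_0^t\Phi(v_s(\lambda))\,ds$. $\Delta X_s=X_s-X_{s-}$ for $s>0$. *)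

(* Defs.v *)
From HB Require Import structures.
From mathcomp Require Import all_boot all_order all_algebra.
From mathcomp Require Import all_classical all_reals all_analysis.
From mathcomp Require Import measurable_realfun.

Set Implicit Arguments.
Unset Strict Implicit.
Unset Printing Implicit Defensive.

Import Order.TTheory GRing.Theory Num.Theory.
Import numFieldNormedType.Exports.

Local Open Scope classical_set_scope.
Local Open Scope ring_scope.

(* A measure on (0, +oo) is a Borel measure on R that does not charge
   the complement of (0, +oo). *)
Definition levy_measure (R : realType)
    (pi : {sigma_finite_measure set R -> \bar R}) : Prop :=
  pi (~` `]0%R, +oo[) = 0%E /\
  (\int[pi]_(theta in `]0%R, +oo[) (Num.min theta (theta ^+ 2))%:E < +oo)%E.

Definition branching_mechanism (R : realType) (alpha beta : R)
    (pi : {sigma_finite_measure set R -> \bar R}) (lambda : R) : R :=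
  alpha * lambda + beta * lambda ^+ 2 +
  \int[pi]_(theta in `]0, +oo[)
     (expR (- lambda * theta) - 1 + lambda * theta).

Definition is_branching_mechanism (R : realType) (alpha beta : R)
    (pi : {sigma_finite_measure set R -> \bar R}) (Phi : R -> R) : Prop :=
  [/\ 0 <= beta,
      levy_measure pi,
      {in `[0, +oo[, Phi =1 branching_mechanism alpha beta pi} &
      exists2 lambda, 0 <= lambda & Phi lambda != 0].

(* [v t lambda] is v_t(lambda). Such a [v] is uniquely determined for
   nonnegative arguments, since Phi is locally Lipschitz on [0, +oo).
   Measurability in time is needed for the integral to make sense. *)
Definition cumulant_semigroup (R : realType) (Phi : R -> R)
    (v : R -> R -> R) : Prop :=
  forall lambda : R, 0 <= lambda ->
  [/\ forall t : R, 0 <= t -> 0 <= v t lambda,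
      forall t : R, 0 <= t ->
        exists M : R, forall s : R, 0 <= s <= t -> v s lambda <= M,
      measurable_fun `[(0 : R), +oo[ (v ^~ lambda) &
      forall t : R, 0 <= t ->
        v t lambda =
        lambda - \int[lebesgue_measure]_(s in `[0, t]) Phi (v s lambda)].

Definition rcll (R : realType) (x : R -> R) : Prop :=
  (forall t : R, 0 <= t -> x s @[s --> t^'+] --> x t) /\
  (forall t : R, 0 < t -> cvg (x s @[s --> t^'-])).

Definition jump (R : realType) (x : R -> R) (s : R) : R :=
  x s - lim (x r @[r --> s^'-]).

(* For rcll [x] and 0 < t the set of jumps is nonempty and bounded, so that
   the real-valued [sup] is the true supremum; for a process with rcll paths
   it is moreover measurable, so that its pushforward is its distribution. *)
Definition sup_jump (R : realType) (x : R -> R) (t : R) : R :=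
  sup [set jump x s | s in `]0, t]].

Definition natural_filtration (R : realType) (d : measure_display)
    (T : measurableType d) (X : R -> T -> R) (s : R) : set_system T :=
  <<s \bigcup_(r in `[0, s]) preimage_set_system setT (X r) measurable >>.

(* [P x] is the law of the process started from x; only the [P x] with
   0 <= x and the [X t] with 0 <= t are constrained. *)
Record CB_process (R : realType) (Phi : R -> R) (d : measure_display)
    (T : measurableType d) (P : R -> probability T R) (X : R -> T -> R) :
    Prop := {
  CB_measurable : forall t : R, 0 <= t -> measurable_fun setT (X t) ;
  CB_ge0 : forall (t : R) (w : T), 0 <= t -> 0 <= X t w ;
  CB_rcll : forall w, rcll (X ^~ w) ;
  CB_start : forall x : R, 0 <= x -> P x (X 0 @^-1` [set x]) = 1%E ;
  CB_kernel : forall (t : R) (B : set R), 0 <= t -> measurable B ->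
    measurable_fun `[(0 : R), +oo[ (fun y : R => P y (X t @^-1` B)) ;
  CB_markov : forall (x s t : R) (A : set T) (B : set R),
    0 <= x -> 0 <= s -> 0 <= t -> natural_filtration X s A -> measurable B ->
    P x (A `&` X (s + t) @^-1` B) =
    (\int[P x]_(w in A) P (X s w) (X t @^-1` B))%E ;
  CB_laplace : exists2 v : R -> R -> R, cumulant_semigroup Phi v &
    forall x t lambda : R, 0 <= x -> 0 <= t -> 0 <= lambda ->
      'E_(P x)[fun w => expR (- lambda * X t w)]%E =
      (expR (- x * v t lambda))%:E
}.

Definition mutually_absolutely_continuous (d : measure_display)
    (T : measurableType d) (R : realType) (mu nu : set T -> \bar R) : Prop :=
  mu `<< nu /\ nu `<< mu.

(* Main.v *)
Require Import Defs.
From HB Require Import structures.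
From mathcomp Require Import all_boot all_order all_algebra.
From mathcomp Require Import all_classical all_reals all_analysis.
From mathcomp Require Import measurable_realfun.
From mathcomp Require Import giry ring lra.

Set Implicit Arguments.
Unset Strict Implicit.
Unset Printing Implicit Defensive.

Import Order.TTheory GRing.Theory Num.Theory.
Import numFieldNormedType.Exports.

Local Open Scope classical_set_scope.
Local Open Scope ring_scope.

(* Along the grid of mesh h = t/n, the largest increment M_n of a rcll path
   converges to its largest jump S, so that E[f(S)] = lim E[f(M_n)] for f
   continuous.

   Under P_y, put U = exp(y - X_h).  Then E_y[U^i] = exp(y(i - v_h(i))), which
   is 1 + h y Phi(i) + O(h^2) locally uniformly in y.  Hence, for a polynomial
   p, E_y[(1 - U)^2 p(U)] is h y times
     2 beta p(1) + \int (1 - e^-r)^2 p(e^-r) pi(dr)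
   up to O(h^2); the squared factor kills the drift term.  By Weierstrass
   approximation in the variable u = e^-r, E_y[f(X_h - y)] = h y pi(f) + o(h) for
   every continuous f supported in a bounded interval ]a, b[ with a > 0.

   Upper bound: f(M_n) is at most the sum of f over all increments, so on the
   event {sup X <= K} the Markov property gives E[f(S)] <= t K pi(f).

   Lower bound: f(M_n) is at least the sum over k of f(xi_k) restricted to the
   event that every other increment is at most a.  Exponentials are almost
   supersolutions of the semigroup killed at increments above a: it maps
   exp(- mu y) to something larger than exp(- mu (1 + C h) y) - O(h^2).  This
   bounds from below the probability of no increment above a, before and after
   step k, and yields E[f(S)] >= c pi(f) with c independent of f.

   Regularity of finite Borel measures turns these bounds into domination of
   null sets. *)

(** * Jumps of a path as limits of increments *)

(** Only Laplace transforms and the Markov property are used; [X] is never decomposed into its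
    jumps. Since [X >= 0], [U] is at most [exp y], so its moments exist and a compact interval
    carries the approximation. The delicate direction is the lower bound. The rate of jumps is
    proportional to the state, which may have reached 0, so a positive probability of seeing no
    large increment is not enough before the jump: the mean of the state, restricted to paths
    without large increment that end below a level [K], must be bounded below uniformly in the mesh.
    This is obtained only up to a small time [t / N], so the jump is sought there. For the remaining
    steps up to [t] a positive probability suffices. Killing is affordable because errors of order
    [h^2] over [t / h] steps add up to order [h], while the exponents grow at most by the factor
    [(1 + C h)^n <= exp (C t)]. The constants may depend on the support of [f] but not on [f]
    itself; hence []0, +oo[] is exhausted by bounded intervals away from 0. *)

Definition max_increment (R : realType) (x : R -> R) (t : R) (n : nat) : R :=
  \big[Num.max/0]_(k < n) (x (t * k.+1%:R / n%:R) - x (t * k%:R / n%:R)).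

Section paths.
Context (R : realType).
Implicit Types (x : R -> R) (s t e : R).

Lemma rcll_left x s e : rcll x -> 0 < s -> 0 < e ->
  exists2 d, 0 < d &
    forall r, s - d < r < s -> `|x r - lim (x r @[r --> s^'-])| < e.
Proof.
move=> [_ xl] s0 e0; have /cvgrPdist_lt/(_ _ e0) := xl s s0.
rewrite near_withinE near_nbhs => -[d /= d0 xd].
exists d => // r /andP[sr rs]; rewrite distrC; apply: xd => //=.
by rewrite ltr_norml; apply/andP; split; lra.
Qed.

Lemma rcll_right x s e : rcll x -> 0 <= s -> 0 < e ->
  exists2 d, 0 < d & forall r, s <= r < s + d -> `|x r - x s| < e.
Proof.
move=> [xr _] s0 e0; have /cvgrPdist_lt/(_ _ e0) := xr s s0.
rewrite near_withinE near_nbhs => -[d /= d0 xd].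
exists d => // r /andP[sr rs]; move: sr; rewrite le_eqVlt => /predU1P[<-|sr].
  by rewrite subrr normr0.
rewrite distrC; apply: xd => //=.
by rewrite ltr_norml; apply/andP; split; lra.
Qed.

Lemma rcll_bounded x t : rcll x ->
  exists B, forall r, 0 <= r <= t -> `|x r| <= B.
Proof.
move=> xc.
have /compact_near_coveringP/(_ nat \oo
    (fun i r => 0 <= r -> `|x r| <= i%:R)) := @segment_compact R 0 t.
case=> [s /=|N _ NP]; last first.
  by exists N%:R => r /[dup] rt /andP[r0 _]; apply: (NP N) => //=; rewrite in_itv.
rewrite in_itv/= => /andP[s0 st].
have [d1 d10 xd1] := rcll_right xc s0 ltr01.
(* At [s = 0] there is no left limit; the condition [0 <= r] makes the claim vacuous there. *)
have [d2 [d20 xd2]] : exists d2, 0 < d2 /\ exists l, forall r,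
    0 <= r -> s - d2 < r < s -> `|x r - l| < 1.
  move: s0; rewrite le_eqVlt => /predU1P[<-|s0].
    exists 1; split => //; exists 0 => r r0 /andP[_]; lra.
  have [d2 d20 xd2] := rcll_left xc s0 ltr01.
  by exists d2; split => //; eexists => r _; exact: xd2.
have [l xl] := xd2; have d0 : 0 < Num.min d1 d2 by rewrite lt_min d10.
exists (ball s (Num.min d1 d2), [set i | `|x s| + `|l| + 1 <= i%:R]).
  split; first exact: nbhsx_ballx.
  exact: nbhs_infty_ger.
move=> [r i] /= [+ Bi] r0; rewrite /ball/= lt_min => /andP[sr1 sr2].
apply: le_trans Bi.
move: sr1 sr2; rewrite !ltr_norml => /andP[h1 h2] /andP[h3 h4].
have [rs|rs] := ltP r s.
  have := xl r r0; have : s - d2 < r < s by apply/andP; split; lra.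
  move=> /[swap] /[apply] h; rewrite -(subrK l (x r)).
  rewrite (le_trans (ler_normD _ _))//.
  by have := normr_ge0 (x s); lra.
have : s <= r < s + d1 by apply/andP; split; lra.
move=> /xd1 h; rewrite -(subrK (x s) (x r)) (le_trans (ler_normD _ _))//.
by have := normr_ge0 l; lra.
Qed.

Lemma jump_has_sup x t : rcll x -> 0 < t ->
  has_sup [set jump x s | s in `]0, t]].
Proof.
move=> xc t0; split; first by exists (jump x t), t; rewrite //= in_itv/= t0/=.
have [B xB] := rcll_bounded t xc; exists (B + (B + 1)) => _ [s + <-].
rewrite /= in_itv/= => /andP[s0 st]; rewrite /jump.
have [d d0 xd] := rcll_left xc s0 ltr01.
pose r := s - Num.min (d / 2) (s / 2).
have m0 : 0 < Num.min (d / 2) (s / 2) by rewrite lt_min !divr_gt0.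
have : Num.min (d / 2) (s / 2) <= d / 2 by rewrite ge_min lexx.
have : Num.min (d / 2) (s / 2) <= s / 2 by rewrite ge_min lexx orbT.
move=> ms md; have rs : s - d < r < s by rewrite /r; apply/andP; split; lra.
have r0 : 0 <= r <= t by rewrite /r; apply/andP; split; lra.
have := xB s; rewrite (ltW s0) st => /(_ isT); rewrite ler_norml => /andP[_].
have := xB _ r0; have := xd _ rs; rewrite ler_norml ltr_norml.
by move=> /andP[? ?] /andP[? ?]; lra.
Qed.

Lemma jump_le_sup x t s : rcll x -> 0 < s <= t -> jump x s <= sup_jump x t.
Proof.
move=> xc st; have t0 : 0 < t by case/andP: st; exact: lt_le_trans.
apply: sup_upper_bound; first exact: jump_has_sup.
by exists s => //=; rewrite in_itv.
Qed.

(** Just before [t] the path stays within [e] of its left limit at [t], so a jump there is above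
    [- 3 e]. With [e] a sixth of minus the supremum, this contradicts the bound [- 6 e]. Thus the
    supremum is nonnegative even for a path that only jumps downwards. *)
Lemma sup_jump_ge0 x t : rcll x -> 0 < t -> 0 <= sup_jump x t.
Proof.
move=> xc t0; rewrite leNgt; apply/negP => S0.
pose e := - sup_jump x t / 6; have e0 : 0 < e by rewrite divr_gt0// oppr_gt0.
have [d d0 xd] := rcll_left xc t0 e0.
pose m := Num.min (d / 2) (t / 2).
have m0 : 0 < m by rewrite lt_min !divr_gt0.
have md : m <= d / 2 by rewrite ge_min lexx.
have mt : m <= t / 2 by rewrite ge_min lexx orbT.
have r0 : 0 < t - m by lra.
have [d' d'0 xd'] := rcll_left xc r0 e0.
pose m' := Num.min d' d.
have m'0 : 0 < m' by rewrite lt_min d'0.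
have md' : m' <= d' by rewrite ge_min lexx.
have mt' : m' <= d by rewrite ge_min lexx orbT.
have : 0 < t - m <= t by apply/andP; split; lra.
move=> /(jump_le_sup xc); rewrite /jump.
have /xd : t - d < t - m < t by apply/andP; split; lra.
have /xd : t - d < t - m - m' / 3 < t by apply/andP; split; lra.
have /xd' : t - m - d' < t - m - m' / 3 < t - m by apply/andP; split; lra.
rewrite !ltr_norml => /andP[? ?] /andP[? ?] /andP[? ?] ?.
have : 6 * e = - sup_jump x t by rewrite /e; field.
lra.
Qed.

(** Two times on the same side of [s] give an increment below [e], and [sup_jump_ge0] concludes; two
    times that straddle [s] give at most [jump x s + e]. *)
Lemma rcll_local_increment x t s e : rcll x -> 0 < t -> 0 <= s <= t -> 0 < e ->
  exists2 d, 0 < d & forall p q, 0 <= p -> s - d < p -> p <= q -> q < s + d ->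
    x q - x p <= sup_jump x t + e.
Proof.
move=> xc t0 /andP[s0 st] e0; have S0 := sup_jump_ge0 xc t0.
have e20 : 0 < e / 2 by rewrite divr_gt0.
have [d1 d10 xd1] := rcll_right xc s0 e20.
move: s0; rewrite le_eqVlt => /predU1P[s0|s0].
  exists d1 => // p q p0 _ pq qd.
  have /xd1 : s <= p < s + d1 by apply/andP; split; lra.
  have /xd1 : s <= q < s + d1 by apply/andP; split; lra.
  by rewrite !ltr_norml => /andP[? ?] /andP[? ?]; lra.
have [d2 d20 xd2] := rcll_left xc s0 e20.
have : 0 < s <= t by rewrite s0.
move=> /(jump_le_sup xc); rewrite /jump => sS.
exists (Num.min d1 d2); first by rewrite lt_min d10.
have m1 : Num.min d1 d2 <= d1 by rewrite ge_min lexx.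
have m2 : Num.min d1 d2 <= d2 by rewrite ge_min lexx orbT.
move=> p q _ sp pq qs; have [qls|sq] := ltP q s.
  have /xd2 : s - d2 < p < s by apply/andP; split; lra.
  have /xd2 : s - d2 < q < s by apply/andP; split; lra.
  by rewrite !ltr_norml => /andP[? ?] /andP[? ?]; lra.
have /xd1 : s <= q < s + d1 by apply/andP; split; lra.
have [pls|sp'] := ltP p s.
  have /xd2 : s - d2 < p < s by apply/andP; split; lra.
  by rewrite !ltr_norml => /andP[? ?] /andP[? ?]; lra.
have /xd1 : s <= p < s + d1 by apply/andP; split; lra.
by rewrite !ltr_norml => /andP[? ?] /andP[? ?]; lra.
Qed.

Lemma rcll_increment_le x t e : rcll x -> 0 < t -> 0 < e ->
  exists2 d, 0 < d & forall p q, 0 <= p -> p <= q -> q <= t -> q < p + d ->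
    x q - x p <= sup_jump x t + e.
Proof.
move=> xc t0 e0.
have /compact_near_coveringP/(_ R 0^'+ (fun d p => forall q, 0 <= p -> p <= q ->
    q < p + d -> x q - x p <= sup_jump x t + e)) := @segment_compact R 0 t.
case=> [s /=|d /= d0 dP]; last first.
  exists (d / 2) => [|p q p0 pq qt qp]; first by rewrite divr_gt0.
  apply: (dP (d / 2)) => //=.
  - by rewrite sub0r normrN gtr0_norm ?divr_gt0//; lra.
  - by rewrite divr_gt0.
  - by rewrite in_itv/= p0; lra.
rewrite in_itv/= => st; have [d d0 xd] := rcll_local_increment xc t0 st e0.
exists (ball s (d / 2), [set r | r < d / 2]).
  split; first by apply: nbhsx_ballx; rewrite divr_gt0.
  by apply: nbhs_right_lt; rewrite divr_gt0.
move=> [p r] /= []; rewrite /ball/= => sp rd q p0 pq qpr.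
move: sp; rewrite ltr_norml => /andP[? ?]; apply: xd => //; lra.
Qed.

Lemma le_max_increment x t n (k : 'I_n) :
  x (t * k.+1%:R / n%:R) - x (t * k%:R / n%:R) <= max_increment x t n.
Proof. by rewrite /max_increment; exact: (@le_bigmax _ _ _ 0 _ k). Qed.

(** The witness is the cell []t k / n, t (k + 1) / n]] that contains [s]: its left end is strictly
    before [s], where the path is close to the left limit, and its right end is at or just after
    [s]. *)
Lemma max_increment_ge x t s e : rcll x -> 0 < s <= t -> 0 < e ->
  \forall n \near \oo, jump x s - e <= max_increment x t n.
Proof.
move=> xc /andP[s0 st] e0; have t0 : 0 < t by exact: lt_le_trans st.
have e20 : 0 < e / 2 by rewrite divr_gt0.
have [d1 d10 xd1] := rcll_right xc (ltW s0) e20.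
have [d2 d20 xd2] := rcll_left xc s0 e20.
have d0 : 0 < Num.min d1 d2 by rewrite lt_min d10.
have m1 : Num.min d1 d2 <= d1 by rewrite ge_min lexx.
have m2 : Num.min d1 d2 <= d2 by rewrite ge_min lexx orbT.
near=> n.
have n0 : (0 < n)%N by near: n; exists 1%N.
have n0R : 0 < n%:R :> R by rewrite ltr0n.
have tn : t / n%:R < Num.min d1 d2.
  rewrite ltr_pdivrMr// -ltr_pdivrMl// mulrC.
  by near: n; exact: nbhs_infty_gtr.
have /ex_minnP[k kP kmin] : exists k, s <= t * k.+1%:R / n%:R.
  by exists n.-1; rewrite prednK// mulfK// gt_eqF.
have kn : (k < n)%N.
  have : (k <= n.-1)%N by apply: kmin; rewrite prednK// mulfK// gt_eqF.
  by rewrite -ltnS prednK.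
have ks : t * k%:R / n%:R < s.
  case: k kmin {kP kn} => [_|k kmin]; first by rewrite mulr0 mul0r.
  by rewrite ltNge; apply/negP => /kmin; rewrite ltnn.
apply: le_trans (le_max_increment x t (Ordinal kn)) => /=.
have kE : t * k.+1%:R / n%:R = t * k%:R / n%:R + t / n%:R.
  by rewrite -[in LHS]natr1; field; rewrite gt_eqF.
have /xd1 : s <= t * k.+1%:R / n%:R < s + d1 by rewrite kP/=; lra.
have /xd2 : s - d2 < t * k%:R / n%:R < s by rewrite ks andbT; lra.
rewrite !ltr_norml /jump => /andP[? ?] /andP[? ?]; lra.
Unshelve. all: end_near. Qed.

Lemma max_increment_cvg x t : rcll x -> 0 < t ->
  max_increment x t n @[n --> \oo] --> sup_jump x t.
Proof.
move=> xc t0; apply/cvgrPdist_le => e e0.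
have e20 : 0 < e / 2 by rewrite divr_gt0.
have [_ [s + <-] Ss] := sup_adherent e20 (jump_has_sup xc t0).
rewrite /= in_itv/= => st.
have [d d0 xd] := rcll_increment_le xc t0 e0.
near=> n.
have n0 : (0 < n)%N by near: n; exists 1%N.
have n0R : 0 < n%:R :> R by rewrite ltr0n.
have tn : t / n%:R < d.
  rewrite ltr_pdivrMr// -ltr_pdivrMl// mulrC.
  by near: n; exact: nbhs_infty_gtr.
have h1 : jump x s - e / 2 <= max_increment x t n.
  by near: n; exact: max_increment_ge.
have h2 : max_increment x t n <= sup_jump x t + e.
  apply: bigmax_le => [|k _]; first by have := sup_jump_ge0 xc t0; lra.
  have kE : t * k.+1%:R / n%:R = t * k%:R / n%:R + t / n%:R.
    by rewrite -[in LHS]natr1; field; rewrite gt_eqF.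
  have t'0 : 0 < t / n%:R by rewrite divr_gt0.
  apply: xd.
  - by rewrite divr_ge0 ?mulr_ge0// ltW.
  - by lra.
  - by rewrite ler_pdivrMr// ler_pM2l// ler_nat.
  - by lra.
rewrite -/(sup_jump x t) in Ss.
by rewrite ler_norml; apply/andP; split; lra.
Unshelve. all: end_near. Qed.

End paths.

(** * Branching mechanism and cumulant semigroup *)

(** Applied below to the integral of [Phi (v s l)] over [[0, h]], with [c = 0] for the first-order
    bound and [c = Phi l] for the second-order one. *)
Lemma Rintegral_near_cst d (T : measurableType d) (R : realType)
    (mu : {measure set T -> \bar R}) (D : set T) (f : T -> R) (c B : R) :
  measurable D -> (mu D < +oo)%E -> measurable_fun D f ->
  (forall x, D x -> `|f x - c| <= B) ->
  `|\int[mu]_(x in D) f x - c * fine (mu D)| <= B * fine (mu D).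
Proof.
move=> mD Dfin mf fB.
have ifc r : mu.-integrable D (EFin \o cst r).
  apply: measurable_bounded_integrable => //.
  exact: bounded_cst.
have ifc' : mu.-integrable D (EFin \o f).
  apply: (measurable_bounded_integrable mD Dfin mf).
  exists (`|c| + B); split; first exact: num_real.
  move=> M cM x Dx /=; rewrite -(subrK c (f x)) (le_trans (ler_normD _ _))//.
  by rewrite addrC (le_trans _ (ltW cM))// lerD2l fB.
rewrite -(Rintegral_cst mu mD) -RintegralB//; last exact: ifc.
have ifB : mu.-integrable D (EFin \o (fun x => f x - c)).
  by have := integrableB mD ifc' (ifc c); apply: eq_integrable.
rewrite (le_trans (le_normr_Rintegral mD ifB))//.
rewrite -(Rintegral_cst mu mD); apply: le_Rintegral => //;
  [exact: integrable_norm ifB | exact: ifc].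
Qed.

Section branching.
Context (R : realType) (pi : {sigma_finite_measure set R -> \bar R}).
Hypothesis pi_levy : levy_measure pi.
Implicit Types (l m a b theta : R).

Let kernel l theta := expR (- l * theta) - 1 + l * theta.

(** The derivative of the kernel in [l] is [theta (1 - exp (- l theta))], which lies between 0 and
    [M min(theta, theta^2)]. The two tangent inequalities [h1] and [h2] for the exponential replace
    the mean value theorem. *)
Let kernel_diff l m M theta : 0 <= m -> m <= l -> l <= M -> 1 <= M ->
  0 < theta ->
  0 <= kernel l theta - kernel m theta <=
    (l - m) * M * Num.min theta (theta ^+ 2).
Proof.
move=> m0 ml lM M1 th0; rewrite /kernel !mulNr.
set u := l * theta; set w := m * theta.
have wu : w <= u by rewrite /u /w ler_pM2r.
have w0 : 0 <= w by rewrite mulr_ge0// ltW.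
have h1 : expR (- u) * (1 + (u - w)) <= expR (- w).
  have -> : expR (- w) = expR (- u) * expR (u - w).
    by rewrite -expRD; congr expR; ring.
  by rewrite ler_pM2l ?expR_gt0// expR_ge1Dx.
have h2 : expR (- w) * (1 + (w - u)) <= expR (- u).
  have -> : expR (- u) = expR (- w) * expR (w - u).
    by rewrite -expRD; congr expR; ring.
  by rewrite ler_pM2l ?expR_gt0// expR_ge1Dx.
have h3 : expR (- w) <= 1 by rewrite -expR0 ler_expR oppr_le0.
have h4 : 1 + - u <= expR (- u) by exact: expR_ge1Dx.
have h5 := expR_gt0 (- u).
have uE : u - w = (l - m) * theta by rewrite /u /w; ring.
apply/andP; split; first by nra.
have : (u - w) * (1 - expR (- u)) <= (l - m) * M * Num.min theta (theta ^+ 2).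
  rewrite uE -!mulrA ler_wpM2l ?subr_ge0// minr_pMr; last by lra.
  rewrite le_min; apply/andP; split.
    rewrite (@le_trans _ _ (1 * theta))//; last by rewrite ler_pM2r.
    by rewrite mulrC ler_pM2r//; lra.
  rewrite expr2 mulrA mulrC ler_pM2r//.
  by rewrite (@le_trans _ _ u)//; [lra | rewrite /u ler_pM2r].
by apply: le_trans; nra.
Qed.

Let mpos : measurable (`]0%R, +oo[ : set R).
Proof. exact: measurable_itv. Qed.

Lemma integrable_levy_min :
  pi.-integrable `]0, +oo[ (EFin \o fun theta => Num.min theta (theta ^+ 2)).
Proof.
apply/integrableP; split.
  apply/measurable_EFinP/measurable_funTS.
  by apply: measurable_minr => //; exact: measurable_funX.
have [_] := pi_levy; apply: le_lt_trans.
rewrite le_eqVlt; apply/orP; left; apply/eqP.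
apply: eq_integral => theta; rewrite inE/= in_itv/= andbT => th0.
by rewrite ger0_norm// le_min (ltW th0) sqr_ge0.
Qed.

Let levy_mass := \int[pi]_(theta in `]0, +oo[) Num.min theta (theta ^+ 2).

Lemma integrable_levy_kernel l : 0 <= l ->
  pi.-integrable `]0, +oo[
    (EFin \o fun theta => expR (- l * theta) - 1 + l * theta).
Proof.
move=> l0.
have := integrableZl mpos (l * (l + 1)) integrable_levy_min.
apply: le_integrable => //.
  apply/measurable_EFinP/measurable_funTS; apply: measurable_funD.
    by apply: measurable_funB => //; apply: measurableT_comp => //;
      exact: mulrl_measurable.
  exact: mulrl_measurable.
move=> theta /=; rewrite in_itv/= andbT => th0; rewrite lee_fin.
have l1 : l <= l + 1 by lra.
have l2 : 1 <= l + 1 by lra.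
have := kernel_diff (lexx 0) l0 l1 l2 th0; rewrite /kernel.
rewrite oppr0 !mul0r expR0 subrr addr0 !subr0 => /andP[k0 k1].
rewrite ger0_norm//; apply: (le_trans k1); rewrite addr0 ler_norm//.
Qed.

Lemma branching_mechanism_lip alpha beta M : 0 <= beta ->
  exists2 C, 0 <= C & forall l m, 0 <= l <= M -> 0 <= m <= M ->
    `|branching_mechanism alpha beta pi l - branching_mechanism alpha beta pi m|
      <= C * `|l - m|.
Proof.
move=> b0; pose N := Num.max 1 M.
have N1 : 1 <= N by rewrite le_max lexx.
have NM : M <= N by rewrite le_max lexx orbT.
have I0 : 0 <= levy_mass.
  apply: Rintegral_ge0 => theta /=; rewrite in_itv/= andbT => th0.
  by rewrite le_min (ltW th0) sqr_ge0.
exists (`|alpha| + beta * (2 * N) + N * levy_mass).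
  by rewrite !addr_ge0// mulr_ge0//; lra.
suff main l m : 0 <= m -> m <= l -> l <= M ->
    `|branching_mechanism alpha beta pi l - branching_mechanism alpha beta pi m|
      <= (`|alpha| + beta * (2 * N) + N * levy_mass) * `|l - m|.
  move=> l m /andP[l0 lM] /andP[m0 mM]; have [ml|lm] := leP m l.
    exact: main.
  by rewrite distrC [in leRHS]distrC; apply: main => //; exact: ltW.
move=> m0 ml lM; rewrite /branching_mechanism.
have l0 : 0 <= l by exact: le_trans ml.
set Il := Rintegral _ _ _; set Im := Rintegral _ _ _.
have /andP[I1 I2] : 0 <= Il - Im <= (l - m) * N * levy_mass.
  rewrite /Il /Im -RintegralB//; [|exact: integrable_levy_kernel..].
  rewrite -[X in _ && (_ <= X)]RintegralZl//; last exact: integrable_levy_min.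
  apply/andP; split.
    apply: Rintegral_ge0 => theta /=; rewrite in_itv/= andbT => th0.
    by have /andP[] := kernel_diff m0 ml (le_trans lM NM) N1 th0.
  apply: le_Rintegral => //.
  - have := integrableB mpos (integrable_levy_kernel l0)
      (integrable_levy_kernel m0).
    by apply: eq_integrable.
  - have := integrableZl mpos ((l - m) * N) integrable_levy_min.
    by apply: eq_integrable.
  - move=> theta; rewrite /= in_itv/= andbT => th0.
    by have /andP[] := kernel_diff m0 ml (le_trans lM NM) N1 th0.
rewrite [X in `|X|](_ : _ = alpha * (l - m) + (beta * (l + m)) * (l - m) +
    (Il - Im)); last by ring.
rewrite (le_trans (ler_normD _ _))// mulrDl lerD//; last first.
  by rewrite ger0_norm// (le_trans I2)// ger0_norm ?subr_ge0//; nra.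
rewrite (le_trans (ler_normD _ _))// !normrM mulrDl lerD2l.
rewrite ler_wpM2r// (ger0_norm b0) ler_wpM2l// ger0_norm; nra.
Qed.

End branching.

Section cumulant.
Context (R : realType) (alpha beta : R)
  (pi : {sigma_finite_measure set R -> \bar R}) (Phi : R -> R).
Hypothesis PhiP : is_branching_mechanism alpha beta pi Phi.
Implicit Types (l h t : R).

Lemma Phi_lip M : exists2 C, 0 <= C & forall l m, 0 <= l <= M -> 0 <= m <= M ->
  `|Phi l - Phi m| <= C * `|l - m|.
Proof.
have [b0 levy PhiE _] := PhiP.
have [C C0 CP] := branching_mechanism_lip levy alpha M b0.
exists C => // l m lM mM; rewrite !PhiE ?in_itv/= ?andbT; first exact: CP.
- by case/andP: mM.
- by case/andP: lM.
Qed.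

(** [Phi] is unconstrained on negative arguments, so it is compared with [Phi (Num.max y 0)], which
    is continuous on the whole line. *)
Lemma measurable_Phi : measurable_fun `[(0 : R), +oo[ Phi.
Proof.
apply: (eq_measurable_fun (fun y : R => Phi (Num.max y 0) : R)) => [y|].
  by rewrite inE/= in_itv/= andbT => y0; rewrite max_l.
apply: measurable_funTS; apply: continuous_measurable_fun => y.
apply/cvgrPdist_le => e e0.
have [C C0 CP] := Phi_lip (`|y| + 1).
near=> z.
have zy : `|y - z| <= 1 by near: z; exact: cvgr_dist_le.
have zy' : `|y - z| <= e / (C + 1).
  by near: z; apply: cvgr_dist_le => //; rewrite divr_gt0//; lra.
have zb : `|z| <= `|y| + 1.
  rewrite -[z](subKr y) (le_trans (ler_normB _ _))//; lra.
have bnd w : `|w| <= `|y| + 1 -> 0 <= Num.max w 0 <= `|y| + 1.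
  move=> wy; rewrite le_max lexx orbT/= ge_max (le_trans (ler_norm _) wy).
  by rewrite addr_ge0.
have yb : `|y| <= `|y| + 1 by lra.
rewrite (le_trans (CP _ _ (bnd _ yb) (bnd _ zb)))//.
have mm : `|Num.max y 0 - Num.max z 0| <= `|y - z|.
  have [h1|h1] := leP y 0; have [h2|h2] := leP z 0.
  - by rewrite subrr normr0.
  - by rewrite sub0r normrN gtr0_norm// ler0_norm; lra.
  - by rewrite subr0 gtr0_norm// ger0_norm; lra.
  - by [].
rewrite (@le_trans _ _ (C * (e / (C + 1))))//.
  by rewrite ler_wpM2l// (le_trans mm).
by rewrite mulrA ler_pdivrMr; nra.
Unshelve. all: end_near. Qed.

(** The integral equation is used twice. Boundedness of [v] on [[0, 1]] first gives
    [l - v h l = O(h)]; fed back through the Lipschitz bound on [Phi], this turns the integrand into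
    [Phi l + O(h)]. *)
Lemma cumulant_expansion v l : cumulant_semigroup Phi v -> 0 <= l ->
  exists2 C, 0 <= C & forall h, 0 <= h <= 1 ->
    `|l - v h l| <= C * h /\ `|l - v h l - h * Phi l| <= C * h ^+ 2.
Proof.
move=> vP l0; have [v_ge0 v_bnd mv vE] := vP l l0.
have [M vM] := v_bnd 1 ler01.
pose N := Num.max l M.
have [C C0 CP] := Phi_lip N.
pose B := `|Phi l| + C * N.
have N0 : 0 <= N by rewrite le_max l0.
have B0 : 0 <= B by rewrite addr_ge0// mulr_ge0.
have lN : 0 <= l <= N by rewrite l0 le_max lexx.
have vN h : 0 <= h <= 1 -> 0 <= v h l <= N.
  by move=> h01; rewrite v_ge0 ?le_max ?vM ?orbT//; case/andP: h01.
have mPhiv h : measurable_fun `[0, h] (fun s => Phi (v s l)).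
  apply: (@measurable_comp _ _ _ R R R `[0, +oo[ Phi `[0, h] (v ^~ l)) => //.
  - move=> _ [s + <-]; rewrite /= !in_itv/= andbT => /andP[s0 _].
    exact: v_ge0.
  - exact: measurable_Phi.
  - apply: measurable_funS mv => // s; rewrite /= !in_itv/= andbT.
    by case/andP.
have lebh h : 0 <= h -> fine (lebesgue_measure (`[0, h] : set R)) = h.
  by move=> h0; rewrite lebesgue_measure_itv/= lte_fin; case: ltP => //=;
    [rewrite oppr0 addr0 | move=> hh; apply/eqP; rewrite eq_le h0 hh].
have lebfin h : (lebesgue_measure (`[0%R, h] : set R) < +oo)%E.
  by rewrite lebesgue_measure_itv/=; case: ifPn => // _; rewrite -EFinD ltry.
have first h : 0 <= h <= 1 -> `|l - v h l| <= B * h.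
  move=> h01; have /andP[h0 h1] := h01; rewrite vE// subKr.
  have := @Rintegral_near_cst _ _ _ lebesgue_measure `[0, h] _ 0 B
    (measurable_itv _) (lebfin h) (mPhiv h).
  rewrite mul0r !subr0 lebh//; apply => s.
  rewrite /= in_itv/= => /andP[s0 sh]; rewrite subr0.
  rewrite -(subrK (Phi l) (Phi _)) (le_trans (ler_normD _ _))// addrC lerD2l.
  have s01 : 0 <= s <= 1 by rewrite s0 (le_trans sh).
  rewrite (le_trans (CP _ _ (vN _ s01) lN))// ler_wpM2l//.
  have := vN _ s01; rewrite ler_norml => /andP[? ?].
  by have /andP[? ?] := lN; apply/andP; split; lra.
exists (B + C * B); first by rewrite addr_ge0 ?mulr_ge0.
move=> h h01; have /andP[h0 h1] := h01; split.
  by rewrite (le_trans (first h h01))// ler_wpM2r// lerDl mulr_ge0.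
rewrite vE// subKr.
have := @Rintegral_near_cst _ _ _ lebesgue_measure `[0, h] _ (Phi l)
  (C * (B * h)) (measurable_itv _) (lebfin h) (mPhiv h).
rewrite lebh// [Phi l * h]mulrC => /(_ _)/le_trans; apply; last first.
  by have : 0 <= B * h ^+ 2; [rewrite mulr_ge0 ?sqr_ge0 | nra].
move=> s; rewrite /= in_itv/= => /andP[s0 sh].
have s01 : 0 <= s <= 1 by rewrite s0 (le_trans sh).
rewrite (le_trans (CP _ _ (vN _ s01) lN))// ler_wpM2l//.
by rewrite distrC (le_trans (first s s01))// ler_wpM2l.
Qed.

End cumulant.

(** * Polynomial approximation *)

Section weierstrass.
Context (R : realType).
Implicit Types (f : R -> R) (phi psi : nat -> R) (e : R).

(* [bernstein n phi] is the Bernstein polynomial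
   \sum_k phi k 'C(n, k) 'X^k (1 - 'X)^(n - k), i.e. the expectation of
   [phi] at a sum of [n] Bernoulli variables, computed by conditioning on
   the first one. *)
Fixpoint bernstein n phi : {poly R} :=
  if n is n'.+1 then
    'X * bernstein n' (phi \o succn) + (1 - 'X) * bernstein n' phi
  else (phi 0%N)%:P.

(** Positivity of the Bernstein operator: it carries bounds on the values at the nodes over to the
    polynomial. *)
Lemma bernstein_le n phi psi u : 0 <= u <= 1 ->
  (forall k, (k <= n)%N -> phi k <= psi k) ->
  (bernstein n phi).[u] <= (bernstein n psi).[u].
Proof.
move=> /andP[u0 u1]; elim: n phi psi => [|n IH] phi psi h /=.
  by rewrite !hornerC h.
rewrite !hornerE lerD// ler_wpM2l ?subr_ge0//.
  by apply: IH => k kn; exact: h.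
by apply: IH => k kn; apply: h; exact: leq_trans kn _.
Qed.

(** Second moment of a binomial variable about [b]. At [b = n u] only the variance [n u (1 - u)]
    remains. *)
Lemma bernstein_sqr n (a c b u : R) :
  (bernstein n (fun k => a + c * (k%:R - b) ^+ 2)).[u] =
  a + c * ((n%:R * u - b) ^+ 2 + n%:R * u * (1 - u)).
Proof.
elim: n b => [|n IH] b /=; first by rewrite hornerC; ring.
rewrite !hornerE IH.
have -> : (fun k => a + c * (k%:R - b) ^+ 2) \o succn =
    (fun k : nat => a + c * (k%:R - (b - 1)) ^+ 2).
  by apply/funext => k /=; rewrite -natr1; ring.
by rewrite IH -natr1; ring.
Qed.

Lemma unit_interval_bounded f : continuous f ->
  exists N : R, forall u : R, 0 <= u <= 1 -> `|f u| <= N.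
Proof.
move=> cf.
have /compact_near_coveringP/(_ nat \oo (fun i r => `|f r| <= i%:R)) :=
  @segment_compact R 0 1.
case=> [s _|N _ NP]; last first.
  by exists N%:R => r r01; apply: (NP N) => //=; rewrite in_itv.
exists ([set r | `|f s - f r| < 1], [set i | `|f s| + 1 <= i%:R]).
  split; last exact: nbhs_infty_ger.
  by have /cvgrPdist_lt/(_ _ ltr01) := cf s.
move=> [r i] /= [h1 h2]; apply: le_trans h2.
rewrite -[f r](subKr (f s)) (le_trans (ler_normB _ _))// lerD2l; exact: ltW.
Qed.

Lemma unit_interval_unif_continuous f e : continuous f -> 0 < e ->
  exists2 d : R, 0 < d & forall u w : R, 0 <= u <= 1 -> `|w - u| < d ->
    `|f w - f u| < e.
Proof.
move=> cf e0.
have /compact_near_coveringP/(_ R 0^'+ (fun d u =>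
    forall w, `|w - u| < d -> `|f w - f u| < e)) := @segment_compact R 0 1.
case=> [s _|d /= d0 dP]; last first.
  exists (d / 2) => [|u w u01 wu]; first by rewrite divr_gt0.
  apply: (dP (d / 2)) => //=.
  - by rewrite sub0r normrN gtr0_norm ?divr_gt0//; lra.
  - by rewrite divr_gt0.
have e20 : 0 < e / 2 by rewrite divr_gt0.
have /cvgrPdist_lt/(_ _ e20)[d /= d0 fd] := cf s.
exists (ball s (d / 2), [set r | r < d / 2]).
  split; first by apply: nbhsx_ballx; rewrite divr_gt0.
  by apply: nbhs_right_lt; rewrite divr_gt0.
move=> [u r] /= []; rewrite /ball/= => su rd w wu.
have /fd : `|s - u| < d by lra.
have /fd : `|s - w| < d.
  have -> : s - w = (s - u) - (w - u) by ring.
  by rewrite (le_lt_trans (ler_normB _ _))//; lra.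
by rewrite !ltr_norml => /andP[? ?] /andP[? ?]; apply/andP; split; lra.
Qed.

(** Chebyshev's argument: [f (k / n)] differs from [f u] by at most [e / 2] if [k / n] is within [d]
    of [u], and otherwise by at most [2 N], which is then dominated by a parabola centred at [n u].
    The operator maps that parabola to its variance. *)
Lemma weierstrass_unit f e : continuous f -> 0 < e ->
  exists p : {poly R}, forall u : R, 0 <= u <= 1 -> `|f u - p.[u]| <= e.
Proof.
move=> cf e0; have [N fN] := unit_interval_bounded cf.
have e20 : 0 < e / 2 by rewrite divr_gt0.
have [d d0 fd] := unit_interval_unif_continuous cf e20.
have N0 : 0 <= N by apply: le_trans (fN 0 _); rewrite ?lexx ?ler01.
(* This size makes the variance term [c n], that is [2 N / (d^2 n)], at most [e / 2]. *)
pose n := (Num.truncn (4 * N / (d ^+ 2 * e))).+1.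
have n0 : 0 < n%:R :> R by rewrite ltr0n.
have nE : 4 * N <= n%:R * (d ^+ 2 * e).
  rewrite -ler_pdivrMr ?mulr_gt0 ?exprn_gt0//; apply: ltW.
  exact: truncnS_gt.
exists (bernstein n (fun k => f (k%:R / n%:R))) => u u01.
have /andP[u0 u1] := u01.
pose c := 2 * N / (d ^+ 2 * n%:R ^+ 2).
have c0 : 0 <= c.
  by apply: divr_ge0; [lra | rewrite mulr_ge0 ?exprn_ge0 ?ltW].
have key k : (k <= n)%N ->
    `|f (k%:R / n%:R) - f u| <= e / 2 + c * (k%:R - n%:R * u) ^+ 2.
  move=> kn; have k01 : 0 <= (k%:R / n%:R : R) <= 1.
    apply/andP; split; first by rewrite divr_ge0 ?ler0n.
    by rewrite ler_pdivrMr// mul1r ler_nat.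
  have [ku|ku] := ltP `|k%:R / n%:R - u| d.
    rewrite (le_trans (ltW (fd _ _ u01 ku)))// lerDl mulr_ge0// sqr_ge0//.
  have h2 : `|f (k%:R / n%:R) - f u| <= 2 * N.
    rewrite (le_trans (ler_normB _ _))//.
    by have := fN _ u01; have := fN _ k01; lra.
  apply: (le_trans h2).
  have -> : c * (k%:R - n%:R * u) ^+ 2 =
      2 * N * ((k%:R / n%:R - u) ^+ 2 / d ^+ 2).
    by rewrite /c; field; rewrite !gt_eqF.
  have : 1 <= (k%:R / n%:R - u) ^+ 2 / d ^+ 2.
    rewrite ler_pdivlMr ?exprn_gt0// mul1r.
    rewrite -[leRHS]ger0_norm ?sqr_ge0// normrX.
    by rewrite lerXn2r// ?nnegrE// ltW.
  by nra.
have bnd : c * (n%:R * u * (1 - u)) <= e / 2.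
  have : n%:R * u * (1 - u) <= n%:R by nra.
  move=> /(ler_wpM2l c0)/le_trans; apply.
  rewrite /c ler_pdivlMr// expr2 invfM !mulrA.
  rewrite [X in X <= _](_ : _ = 4 * N / (d ^+ 2 * n%:R)); last first.
    by field; rewrite !gt_eqF.
  by rewrite ler_pdivrMr ?mulr_gt0 ?exprn_gt0//; lra.
have up : (bernstein n (fun k => f (k%:R / n%:R))).[u] <= f u + e.
  have := @bernstein_le n (fun k => f (k%:R / n%:R))
    (fun k => (f u + e / 2) + c * (k%:R - n%:R * u) ^+ 2) u u01.
  rewrite bernstein_sqr subrr expr0n/= add0r => /(_ _)/le_trans; apply.
    by move=> k /key; rewrite ler_norml => /andP[? ?]; lra.
  lra.
have dn : f u - e <= (bernstein n (fun k => f (k%:R / n%:R))).[u].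
  have := @bernstein_le n
    (fun k => (f u - e / 2) + (- c) * (k%:R - n%:R * u) ^+ 2)
    (fun k => f (k%:R / n%:R)) u u01.
  rewrite bernstein_sqr subrr expr0n/= add0r => /(_ _)/(le_trans _); apply.
    by lra.
  by move=> k /key; rewrite ler_norml => /andP[? ?]; lra.
by rewrite ler_norml; apply/andP; split; lra.
Qed.

Lemma weierstrass f (M e : R) : continuous f -> 0 < M -> 0 < e ->
  exists p : {poly R}, forall u : R, 0 <= u <= M -> `|f u - p.[u]| <= e.
Proof.
move=> cf M0 e0; have [|p pP] := @weierstrass_unit (fun u => f (M * u)) e _ e0.
  by move=> u; apply: continuous_comp; [exact: mulrl_continuous|exact: cf].
exists (p \Po (M^-1 *: 'X)) => u /andP[u0 uM].
rewrite horner_comp !hornerE.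
have := pP (M^-1 * u); rewrite mulrA divff ?gt_eqF// mul1r; apply.
by rewrite mulr_ge0 ?invr_ge0 ?(ltW M0)//= mulrC ler_pdivrMr// mul1r.
Qed.

End weierstrass.

(** * Comparison of measures by continuous functions *)

Section regularity.
Context (R : realType) (mu : {measure set R -> \bar R}).
Hypothesis mufin : (mu setT < +oo)%E.
Local Open Scope ereal_scope.

(** The sets with inner closed and outer open approximation. They form a sigma-algebra containing
    the rays [[x, +oo[], hence all Borel sets. *)
Let sandwich : set_system R :=
  [set A : set R | measurable A /\ forall e : R, (0 < e)%R ->
     exists F G : set R,
     [/\ closed F, open G, F `<=` A, A `<=` G & mu (G `\` F) <= e%:E]].

Let fin (B : set R) : measurable B -> mu B < +oo.
Proof. by move=> mB; apply: le_lt_trans mufin; rewrite le_measure ?inE. Qed.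

Let vanishing (B : (set R)^nat) (e : R) : (0 < e)%R ->
  (forall i, measurable (B i)) -> {homo B : n m / (n <= m)%N >-> m `<=` n} ->
  \bigcap_n B n = set0 -> exists n, mu (B n) <= e%:E.
Proof.
move=> e0 mB ndB B0.
have : (mu \o B) n @[n --> \oo] --> mu (\bigcap_n B n).
  apply: nonincreasing_cvg_mu => //; first exact: fin.
    by rewrite B0.
  by move=> n m nm; apply/subsetPset; exact: ndB.
rewrite B0 measure0 => /fine_cvgP[Bfin /cvgrPdist_le/(_ _ e0) Be].
near \oo => n; exists n.
have nfin : mu (B n) \is a fin_num by near: n; exact: Bfin.
rewrite -(fineK nfin) lee_fin.
have : (`|0 - fine (mu (B n))| <= e)%R by near: n; exact: Be.
by rewrite sub0r normrN; apply: le_trans; exact: ler_norm.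
Unshelve. all: end_near. Qed.

Let sandwich_itv (x : R) : sandwich `[x, +oo[%classic.
Proof.
split; first exact: measurable_itv.
move=> e e0.
have [|||n ne] := @vanishing (fun n => `](x - n.+1%:R^-1)%R, x[%classic) e e0.
- by move=> i; exact: measurable_itv.
- move=> n m nm y /=; rewrite !in_itv/= => /andP[h1 ->]; rewrite andbT.
  apply: le_lt_trans h1; rewrite lerD2l lerN2 lef_pV2 ?posrE//.
  by rewrite ler_nat.
- rewrite -subset0 => y /= h; have := h 0%N Logic.I; rewrite /= in_itv/= => /andP[_ yx].
  have xy : (0 < x - y)%R by rewrite subr_gt0.
  have := h (Num.truncn (x - y)^-1) Logic.I; rewrite /= in_itv/= => /andP[+ _].
  rewrite ltrBlDr addrC -ltrBlDr ltNge => /negP; apply.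
  rewrite -[leRHS]invrK lef_pV2 ?posrE ?invr_gt0//.
  by apply: ltW; exact: truncnS_gt.
exists `[x, +oo[%classic, `](x - n.+1%:R^-1)%R, +oo[%classic; split => //.
- exact: interval_closed.
- by move=> y /=; rewrite !in_itv/= !andbT => xy; apply: lt_le_trans xy; rewrite ltrBlDr ltrDl invr_gt0.
- rewrite [X in mu X](_ : _ = `](x - n.+1%:R^-1)%R, x[%classic)//.
  apply/seteqP; split => y /=; rewrite !in_itv/= !andbT.
    by move=> [-> /negP]; rewrite -ltNge.
  by move=> /andP[-> yx]; split => //; apply/negP; rewrite -ltNge.
Qed.

Let sandwich0 : sandwich set0.
Proof.
split => // e e0; exists set0, set0; split => //.
- exact: closed0.
- by rewrite setD0 measure0 lee_fin ltW.
Qed.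

Let sandwichC A : sandwich A -> sandwich (~` A).
Proof.
move=> [mA hA]; split; first exact: measurableC.
move=> e e0; have [F [G [cF oG FA AG e1]]] := hA e e0.
exists (~` G), (~` F); split.
- exact: open_closedC.
- exact: closed_openC.
- exact: subsetC.
- exact: subsetC.
- by rewrite setDE setCK setIC -setDE.
Qed.

(** A countable union of closed sets need not be closed, so only the finite union [Fn n] is kept.
    Half of [e] pays for the discarded tail, the other half is shared geometrically among the
    approximations of the [A n]. *)
Let sandwich_bigcup (A : (set R)^nat) : (forall n, sandwich (A n)) ->
  sandwich (\bigcup_n A n).
Proof.
move=> hA; split; first by apply: bigcup_measurable => n _; have [] := hA n.
move=> e e0.
have e2 n : (0 < e / 2 / (2 ^ n.+1)%:R)%R by rewrite !divr_gt0// ltr0n expn_gt0.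
pose FG n := (cid (proj2 (hA n) _ (e2 n))).
pose F n := proj1_sig (FG n).
pose G n := proj1_sig (cid (proj2_sig (FG n))).
have FGP n : [/\ closed (F n), open (G n), F n `<=` A n, A n `<=` G n &
    mu (G n `\` F n) <= (e / 2 / (2 ^ n.+1)%:R)%:E].
  exact: (proj2_sig (cid (proj2_sig (FG n)))).
have mF n : measurable (F n) by have [? _ _ _ _] := FGP n; exact: closed_measurable.
have mG n : measurable (G n) by have [_ ? _ _ _] := FGP n; exact: open_measurable.
have mbF : measurable (\bigcup_n F n) by exact: bigcup_measurable.
have mbG : measurable (\bigcup_n G n) by exact: bigcup_measurable.
pose Fn n := \big[setU/set0]_(i < n) F i.
have mFn n : measurable (Fn n) by exact: bigsetU_measurable.
have e20 : (0 < e / 2)%R by rewrite divr_gt0.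
have [|n m nm y []||n ne] := @vanishing (fun n => \bigcup_n F n `\` Fn n) _ e20.
- by move=> i; exact: measurableD.
- move=> Fy FNy; split => // Fny; apply: FNy.
  by apply: subset_bigsetU Fny.
- rewrite -subset0 => y h; have [[i _ Fi] _] := h 0%N Logic.I.
  have [_] := h i.+1 Logic.I; apply.
  by rewrite /Fn big_ord_recr/=; right.
exists (Fn n), (\bigcup_n G n); split.
- by apply: closed_bigsetU => i _; have [] := FGP i.
- by apply: bigcup_open => i _; have [] := FGP i.
- rewrite /Fn -bigcup_mkord => y [i _ Fi]; exists i => //.
  by have [_ _ FA _ _] := FGP i; exact: FA.
- move=> y [i _ Ai]; exists i => //.
  by have [_ _ _ AG _] := FGP i; exact: AG.
have sub : \bigcup_n G n `\` Fn n `<=`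
    \bigcup_n (G n `\` F n) `|` (\bigcup_n F n `\` Fn n).
  move=> y [[i _ Gi] nF]; have [Fi|nFi] := pselect (F i y).
    by right; split => //; exists i.
  by left; exists i.
have mGF i : measurable (G i `\` F i) by exact: measurableD.
have mbGF : measurable (\bigcup_i (G i `\` F i)) by exact: bigcup_measurable.
rewrite (@le_trans _ _ (mu (\bigcup_n (G n `\` F n) `|`
    (\bigcup_n F n `\` Fn n))))//.
  rewrite le_measure// inE; first exact: measurableD.
  by apply: measurableU => //; exact: measurableD.
rewrite (le_trans (measureU2 _ _ _))//; first exact: measurableD.
rewrite [e in e%:E](splitr e) EFinD leeD//.
rewrite (le_trans (generalized_Boole_inequality _ _ _))//.
apply: (@le_trans _ _ (\sum_(0 <= i <oo) (0 + (e / 2 / (2 ^ i.+1)%:R)%:E))).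
  by apply: lee_nneseries => // i _; rewrite add0e; have [] := FGP i.
rewrite (le_trans (epsilon_trick _ _ _))//; first exact: ltW.
by rewrite eseries0// add0e.
Qed.

Lemma finite_measure_sandwich (A : set R) (e : R) : measurable A -> (0 < e)%R ->
  exists F G : set R,
    [/\ closed F, open G, F `<=` A, A `<=` G & mu (G `\` F) <= e%:E].
Proof.
have SA : (@RGenCInfty.G R).-sigma.-measurable `<=` sandwich.
  apply: smallest_sub; last by move=> _ [x ->]; exact: sandwich_itv.
  split; [exact: sandwich0 | | exact: sandwich_bigcup].
  by move=> B; rewrite setTD; exact: sandwichC.
rewrite -RGenCInfty.measurableE in SA.
by move=> /SA[_ +] e0; exact.
Qed.

End regularity.

(** Sandwich [A] between a closed [F] and an open [G], and let [f] be a Urysohn function equal to 1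
    on [F] and 0 off [G] intersected with [D]. Then [mu F] is at most [C] times [nu] of that
    intersection, which is small because [nu A = 0]. Sandwiching for the sum [la] of the two
    restricted measures makes one pair [F], [G] serve both. *)
Lemma le_measure_continuous (R : realType) (mu nu : {measure set R -> \bar R})
    (D : set R) (C : R) : 0 <= C -> open D -> (mu D < +oo)%E -> (nu D < +oo)%E ->
  (forall f : R -> R, continuous f -> (forall r, 0 <= f r <= 1) ->
     (forall r, ~ D r -> f r = 0) ->
     (\int[mu]_r (f r)%:E <= C%:E * \int[nu]_r (f r)%:E)%E) ->
  forall A, measurable A -> A `<=` D -> nu A = 0%E -> mu A = 0%E.
Proof.
move=> C0 oD muD nuD fP A mA AD nuA; have mD := open_measurable oD.
pose la := measure_add (mrestr mu mD) (mrestr nu mD).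
have laE B : measurable B -> la B = (mu (B `&` D) + nu (B `&` D))%E.
  by move=> mB; rewrite /la measure_addE.
have lafin : (la setT < +oo)%E by rewrite laE// !setTI lte_add_pinfty.
apply/eqP; rewrite eq_le measure_ge0 andbT.
apply/lee_addgt0Pr => e e0.
have e'0 : 0 < e / (C + 1) by rewrite divr_gt0//; lra.
have [F [G [cF oG FA AG GF]]] := finite_measure_sandwich lafin mA e'0.
have mF := closed_measurable cF; have mG := open_measurable oG.
have mGF : measurable (G `\` F) by exact: measurableD.
have oGD : open (G `&` D) by exact: openI.
have {}GF : (la (G `\` F) <= (e / (C + 1))%:E)%E by exact: GF.
rewrite laE// in GF.
have muGF : (mu ((G `\` F) `&` D) <= (e / (C + 1))%:E)%E.
  by apply: le_trans GF; rewrite leeDl.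
have nuGF : (nu ((G `\` F) `&` D) <= (e / (C + 1))%:E)%E.
  by apply: le_trans GF; rewrite leeDr.
have sep : uniform_separator (~` (G `&` D)) F.
  apply: normal_uniform_separator => //.
  - exact: (@pseudometric_normal R).
  - exact: open_closedC.
  - rewrite -subset0 => y [/= h Fy]; apply: h; split.
      exact/AG/FA.
    exact/AD/FA.
pose f : R -> R := Urysohn (~` (G `&` D)) F.
have cf : continuous f by exact: Urysohn_continuous.
have f01 r : 0 <= f r <= 1.
  have := @Urysohn_range _ R (~` (G `&` D)) F (f r).
  by rewrite /= in_itv/=; apply; exists r.
have f0 r : ~ (G `&` D) r -> f r = 0.
  by move=> h; have := @Urysohn_sub0 _ R _ _ sep (f r); apply; exists r.
have f1 r : F r -> f r = 1.
  by move=> h; have := @Urysohn_sub1 _ R _ _ sep (f r); apply; exists r.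
have mf : measurable_fun setT (EFin \o f).
  by apply/measurable_EFinP; exact: continuous_measurable_fun.
have mGD : measurable (G `&` D) by exact: measurableI.
have le1 : (mu F <= \int[mu]_r (f r)%:E)%E.
  rewrite -[X in (mu X <= _)%E]setIT -integral_indic//.
  apply: ge0_le_integral => //.
  - exact/measurable_EFinP/measurable_indic.
  - move=> r _; rewrite lee_fin indicE.
    have [/set_mem/f1 ->//|_] := boolP (r \in F).
    by have /andP[] := f01 r.
have le2 : (\int[nu]_r (f r)%:E <= nu (G `&` D))%E.
  rewrite -[X in (_ <= nu X)%E]setIT -integral_indic//.
  apply: ge0_le_integral => //.
  - by move=> r _; rewrite lee_fin; have /andP[] := f01 r.
  - exact/measurable_EFinP/measurable_indic.
  - move=> r _; rewrite lee_fin indicE.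
    have [_|/negP nG] := boolP (r \in G `&` D); first by have /andP[] := f01 r.
    by rewrite f0// => h; apply: nG; rewrite inE.
have mGFD : measurable ((G `\` F) `&` D) by exact: measurableI.
have le3 : (nu (G `&` D) <= (e / (C + 1))%:E)%E.
  have -> : nu (G `&` D) = nu (A `|` (G `&` D)).
    congr (nu _); apply/esym/setUidPr => r Ar; split; [exact: AG|exact: AD].
  rewrite (@le_trans _ _ (nu (A `|` (G `\` F) `&` D)))//.
    rewrite le_measure ?inE//; [exact: measurableU..|].
    move=> r [Ar|[Gr Dr]]; first by left.
    have [Fr|nFr] := pselect (F r); first by left; exact: FA.
    by right.
  by rewrite (le_trans (measureU2 _ _ _))// [X in (X + _)%E](_ : _ = 0%E)// add0e.
have le4 : (mu A <= mu F + mu ((G `\` F) `&` D))%E.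
  rewrite (le_trans _ (measureU2 _ _ _))//.
  rewrite le_measure ?inE//; first exact: measurableU.
  move=> r Ar; have [Fr|nFr] := pselect (F r); first by left.
  by right; split; [split=> //; exact: AG | exact: AD].
have le5 : (mu F <= C%:E * (e / (C + 1))%:E)%E.
  rewrite (le_trans le1)// (le_trans (fP f cf f01 _))//.
    by move=> r nDr; apply: f0 => -[].
  by apply: lee_wpmul2l; [rewrite lee_fin | exact: le_trans le2 le3].
rewrite add0e (le_trans le4)// (le_trans (leeD le5 muGF))//.
rewrite -EFinM -EFinD lee_fin.
have -> : C * (e / (C + 1)) + e / (C + 1) = (C + 1) * (e / (C + 1)) by ring.
by rewrite mulrC divfK// gt_eqF//; lra.
Qed.

(** * Markov property for functions of two consecutive states *)

Lemma ge0_integral_mrestr d (T : measurableType d) (R : realType)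
    (mu : {measure set T -> \bar R}) (D : set T) (mD : measurable D)
    (f : T -> \bar R) : measurable_fun setT f -> (forall w, 0 <= f w)%E ->
  (\int[mrestr mu mD]_w f w = \int[mu]_(w in D) f w)%E.
Proof.
move=> mf f0; rewrite (@ge0_negligible_integral _ _ _ _ setT (~` D))//.
- rewrite setDE setTI setCK; apply: eq_measure_integral => A mA AD.
  by rewrite /= /mrestr setIidl.
- exact: measurableC.
- by rewrite /= /mrestr setICl measure0.
Qed.

Section markov.
Context (R : realType) (Phi : R -> R) (d : measure_display)
  (T : measurableType d) (P : R -> probability T R) (X : R -> T -> R).
Hypothesis HX : CB_process Phi P X.
Implicit Types (x s t h : R) (A : set T).

Let G s := \bigcup_(r in `[0, s]) preimage_set_system setT (X r) measurable.

Lemma natural_filtration_setT s : natural_filtration X s setT.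
Proof. exact: (@measurableT _ (g_sigma_algebraType (G s))). Qed.

Lemma natural_filtrationI s A B : natural_filtration X s A ->
  natural_filtration X s B -> natural_filtration X s (A `&` B).
Proof. exact: (@measurableI _ (g_sigma_algebraType (G s))). Qed.

Let measurable_natural s r : 0 <= r <= s ->
  measurable_fun (setT : set (g_sigma_algebraType (G s))) (X r).
Proof.
move=> rs _ Y mY; rewrite setTI; apply: sub_sigma_algebra.
exists r; first by rewrite /= in_itv.
by exists Y => //; rewrite setTI.
Qed.

Lemma natural_filtration_preimage s r (B : set R) : 0 <= r <= s ->
  measurable B -> natural_filtration X s (X r @^-1` B).
Proof.
by move=> rs mB; have := measurable_natural rs measurableT mB; rewrite setTI.
Qed.

Lemma natural_filtration_increment s q r (B : set R) : 0 <= q <= s ->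
  0 <= r <= s -> measurable B ->
  natural_filtration X s ((fun w => X q w - X r w) @^-1` B).
Proof.
move=> qs rs mB.
have := measurable_funB (measurable_natural qs) (measurable_natural rs).
by move=> /(_ measurableT _ mB); rewrite setTI.
Qed.

Lemma natural_filtration_le s t A : s <= t ->
  natural_filtration X s A -> natural_filtration X t A.
Proof.
move=> st; apply: sub_smallest2r => //; apply: bigcup_subset => r /=.
by rewrite !in_itv/= => /andP[-> /le_trans]; apply.
Qed.

Lemma natural_filtration_measurable s A :
  natural_filtration X s A -> measurable A.
Proof.
apply: smallest_sub; first exact: sigma_algebra_measurable.
move=> B [r]; rewrite /= in_itv/= => /andP[r0 _] [Y mY <-].
exact: CB_measurable HX _ r0 measurableT _ mY.
Qed.

Section integral.
Variables (x s h : R) (A : set T).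
Hypotheses (x0 : 0 <= x) (s0 : 0 <= s) (h0 : 0 <= h)
  (As : natural_filtration X s A).

Let mA : measurable A. Proof. exact: natural_filtration_measurable As. Qed.
Let mXs : measurable_fun setT (X s). Proof. exact: CB_measurable HX _ s0. Qed.
Let mXh : measurable_fun setT (X h). Proof. exact: CB_measurable HX _ h0. Qed.
Let sh0 : 0 <= s + h. Proof. exact: addr_ge0. Qed.
Let mXsh : measurable_fun setT (X (s + h)).
Proof. exact: CB_measurable HX _ sh0. Qed.

Let PA := mrestr (P x) mA.

HB.instance Definition _ := Measure.on PA.

Let PA_le1 : (PA setT <= 1)%E.
Proof. by rewrite /PA /mrestr setTI; exact: probability_le1. Qed.

HB.instance Definition _ := Measure_isSubProbability.Build _ _ _ PA PA_le1.

(** The kernel is indexed by [w] and not by the state: measurability of [P y] in [y] is only given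
    for [y >= 0], where [X s] takes its values. *)
Let law (w : T) : giry R R := giry_map mXh (P (X s w) : giry T R).

Let measurable_law : measurable_fun setT law.
Proof.
apply: measurable_giry_codensity => // B mB.
rewrite (_ : law ^~ B = (fun y => P y (X h @^-1` B)) \o X s)//.
apply: (@measurable_comp _ _ _ T R _ `[0%R, +oo[ _ setT (X s)) => //.
- by move=> _ [w _ <-]; rewrite /= in_itv/= andbT; exact: CB_ge0 HX _ _ _.
- exact: CB_kernel HX _ _ _ _.
Qed.

Let pair_law (w : T) : giry (R * R)%type R :=
  giry_prod (giry_ret (X s w), law w).

Let measurable_pair_law : measurable_fun setT pair_law.
Proof.
apply: (measurableT_comp measurable_giry_prod).
apply/measurable_fun_pairP; split => //=.
exact: (measurableT_comp (@measurable_giry_ret _ R R) mXs).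
Qed.

Let pair_lawE (g : R * R -> \bar R) (w : T) : measurable_fun setT g ->
  (forall z, 0 <= g z)%E ->
  giry_int (pair_law w) g = (\int[P (X s w)]_z g (X s w, X h z))%E.
Proof.
move=> mg g0; rewrite /pair_law giry_int_prod1//.
have mgX : measurable_fun setT (fun y => \int[law w]_z g (y, z))%E.
  exact: measurable_fun_fubini_tonelli_F.
have := giry_int_ret (X s w) mgX; rewrite /giry_int => ->.
rewrite ge0_integral_pushforward//.
by apply: measurableT_comp => //; exact: measurable_pair1.
Qed.

Lemma measurable_markov_integral (g : R * R -> \bar R) :
  measurable_fun setT g -> (forall z, 0 <= g z)%E ->
  measurable_fun setT (fun w => \int[P (X s w)]_z g (X s w, X h z))%E.
Proof.
move=> mg g0; rewrite (_ : (fun w => _) = giry_int ^~ g \o pair_law).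
  exact: (measurableT_comp (measurable_giry_int mg g0) measurable_pair_law).
by apply/funext => w /=; rewrite pair_lawE.
Qed.

Let bindE (g : R * R -> \bar R) : measurable_fun setT g -> (forall z, 0 <= g z)%E ->
  (\int[giry_bind (PA : giry T R) measurable_pair_law]_z g z =
   \int[P x]_(w in A) \int[P (X s w)]_z g (X s w, X h z))%E.
Proof.
move=> mg g0; have := giry_int_bind (PA : giry T R) measurable_pair_law mg g0.
rewrite /giry_int => ->; rewrite ge0_integral_mrestr.
- by apply: eq_integral => w _; exact: pair_lawE.
- exact: (measurableT_comp (measurable_giry_int mg g0) measurable_pair_law).
- by move=> w; exact: integral_ge0.
Qed.

(** Both sides integrate [g] against a finite measure on the plane: the image of [PA] under
    [(X s, X (s + h))], and the mixture of the laws [pair_law]. On rectangles they agree by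
    [CB_markov], and rectangles are a generating pi-system. *)
Lemma markov_integral (g : R * R -> \bar R) :
  measurable_fun setT g -> (forall z, 0 <= g z)%E ->
  (\int[P x]_(w in A) g (X s w, X (s + h)%R w) =
   \int[P x]_(w in A) \int[P (X s w)]_z g (X s w, X h z))%E.
Proof.
move=> mg g0; rewrite -bindE//.
have mXX : measurable_fun setT (fun w => (X s w, X (s + h) w)).
  exact/measurable_fun_pairP.
rewrite -ge0_integral_mrestr//; last exact: measurableT_comp.
have := giry_int_map mXX (PA : giry T R) mg g0; rewrite /giry_int/= => <-.
pose C : set (set (R * R)) :=
  [set C | exists B1, measurable B1 /\ exists B2, measurable B2 /\ C = B1 `*` B2].
apply: eq_measure_integral => D mD _.
apply: (measure_unique C (fun=> setT)) => //.
- rewrite measurable_prod_measurableType; congr (<<s _ >>).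
  apply/seteqP; split => [_ [B1 mB1 [B2 mB2 <-]]|_ [B1 [mB1 [B2 [mB2 ->]]]]].
    by exists B1; split => //; exists B2.
  by exists B1 => //; exists B2.
- move=> _ _ [B1 [mB1 [B2 [mB2 ->]]]] [B1' [mB1' [B2' [mB2' ->]]]].
  rewrite -setXI; exists (B1 `&` B1'); split; first exact: measurableI.
  by exists (B2 `&` B2'); split => //; exact: measurableI.
- by move=> _; exists setT; split => //; exists setT; split => //; rewrite setXTT.
- by rewrite bigcup_const//; exists 0%N.
- move=> _ [B1 [mB1 [B2 [mB2 ->]]]].
  have mB12 : measurable (B1 `*` B2) by exact: measurableX.
  have AB : natural_filtration X s (A `&` X s @^-1` B1).
    apply: natural_filtrationI => //; apply: natural_filtration_preimage => //.
    by rewrite s0 lexx.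
  have mind : measurable_fun setT (EFin \o \1_(B1 `*` B2) : R * R -> \bar R).
    apply: measurableT_comp => //; exact: measurable_indic.
  have E3 : (\int[giry_bind (PA : giry T R) measurable_pair_law]_z
      (EFin \o \1_(B1 `*` B2)) z =
      giry_bind (PA : giry T R) measurable_pair_law (B1 `*` B2))%E.
    by rewrite integral_indic// setIT.
  apply: etrans E3.
  transitivity (P x ((A `&` X s @^-1` B1) `&` X (s + h) @^-1` B2)).
    rewrite /= /pushforward /PA /mrestr; congr (P x _).
    by rewrite setIC -setIA.
  rewrite (CB_markov HX x0 s0 h0 AB mB2).
  rewrite bindE//; last by move=> z; rewrite lee_fin.
  rewrite integral_mkcondr; apply: eq_integral => w _; rewrite /patch.
  have mXB : measurable (X h @^-1` B2).
    by rewrite -[X in measurable X]setTI; exact: mXh.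
  have [wB|wB] := boolP (w \in _).
    transitivity (\int[P (X s w)]_z (\1_(X h @^-1` B2) z)%:E)%E.
      by rewrite integral_indic// setIT.
    apply: eq_integral => z _ /=; rewrite !indicE.
    suff -> : ((X s w, X h z) \in B1 `*` B2) = (z \in X h @^-1` B2) by [].
    move: wB; rewrite inE => wB; apply/idP/idP; rewrite !inE.
      by case.
    by move=> ?; split.
  rewrite integral0_eq// => z _; rewrite /= indicE memNset// => -[/= h1 _].
  by move: wB; rewrite notin_setE; apply.
- move=> _; apply: le_lt_trans (ltry 1).
  by rewrite /= /pushforward preimage_setT; exact: PA_le1.
Qed.

End integral.
End markov.

(** * Transition over a short time step *)

Lemma continuous_bounded_itv (R : realType) (q : R -> R) (M : R) :
  continuous q -> 0 <= M ->
  exists B : R, forall u : R, 0 <= u <= M -> `|q u| <= B.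
Proof.
move=> cq; rewrite le_eqVlt => /predU1P[<-|M0].
  by exists `|q 0| => u u0; rewrite (_ : u = 0)//; apply/eqP; rewrite eq_le andbC.
have [|B BP] := @unit_interval_bounded R (fun u => q (M * u)).
  by move=> u; apply: continuous_comp; [exact: mulrl_continuous|exact: cq].
exists B => u /andP[u0 uM]; have := BP (u / M).
rewrite [M * _]mulrC divfK ?gt_eqF//; apply.
by rewrite divr_ge0 ?(ltW M0)//= ler_pdivrMr// mul1r.
Qed.

Section weighted_integral.
Context d (T : measurableType d) (R : realType) (mu : {measure set T -> \bar R})
  (D : set T) (phi : T -> R) (M : R).
Hypotheses (mD : measurable D) (mphi : measurable_fun D phi) (M0 : 0 <= M)
  (phiM : forall w, D w -> 0 <= phi w <= M)
  (iphi : mu.-integrable D (EFin \o fun w => (1 - phi w) ^+ 2)).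
Implicit Types (q : R -> R) (e u : R).

(** Common form of the two sides of the one-step asymptotics: [phi] is [exp (y - X h)] under [P y],
    and [exp (- theta)] under [pi]. The weight vanishes to second order at [theta = 0], which makes
    it integrable for [pi]. *)
Definition weighted_integral q := \int[mu]_(w in D) ((1 - phi w) ^+ 2 * q (phi w)).

Lemma weighted_integrable q : continuous q ->
  mu.-integrable D (EFin \o fun w => (1 - phi w) ^+ 2 * q (phi w)).
Proof.
move=> cq; have [B BP] := continuous_bounded_itv cq M0.
have := integrableZl mD B iphi; apply: le_integrable => //.
  apply/measurable_EFinP; apply: measurable_funM.
    by apply: measurable_funX; exact: measurable_funB.
  by apply: measurableT_comp => //; exact: continuous_measurable_fun.
move=> w Dw /=; rewrite lee_fin !normrM mulrC ler_wpM2r//.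
by rewrite (le_trans (BP _ (phiM Dw)))// ler_norm.
Qed.

Lemma weighted_integral_dist q1 q2 e : continuous q1 -> continuous q2 ->
  (forall u : R, 0 <= u <= M -> `|q1 u - q2 u| <= e) ->
  `|weighted_integral q1 - weighted_integral q2| <=
    e * weighted_integral (cst 1).
Proof.
move=> c1 c2 q12.
have ccst : continuous (cst 1 : R -> R) by move=> u; exact: cvg_cst.
rewrite /weighted_integral -RintegralB//;
  [|exact: weighted_integrable..].
rewrite (le_trans (le_normr_Rintegral _ _))//.
  by have := integrableB mD (weighted_integrable c1) (weighted_integrable c2);
    apply: eq_integrable.
rewrite -RintegralZl//; last exact: weighted_integrable.
apply: le_Rintegral => //.
- have := integrableB mD (weighted_integrable c1) (weighted_integrable c2).
  by move=> /integrable_norm; apply: eq_integrable.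
- have := integrableZl mD e (weighted_integrable ccst).
  by apply: eq_integrable.
- move=> w Dw; rewrite -mulrBr normrM /= mulr1 mulrC.
  by rewrite (ger0_norm (sqr_ge0 _)) ler_wpM2r ?sqr_ge0// q12// phiM.
Qed.

Lemma weighted_integral_sum n (a : nat -> R) :
  weighted_integral (fun u => \sum_(i < n) a i * u ^+ i) =
  \sum_(i < n) a i * weighted_integral (fun u => u ^+ i).
Proof.
have cX i : continuous (fun u : R => u ^+ i) by exact: exprn_continuous.
have cS k : continuous (fun u : R => \sum_(i < k) a i * u ^+ i).
  move=> u; have -> : (fun u : R => \sum_(i < k) a i * u ^+ i) =
      horner (\poly_(i < k) a i).
    by apply/funext => z; rewrite horner_poly.
  exact: continuous_horner.
elim: n => [|n IH].
  rewrite big_ord0 /weighted_integral; under eq_Rintegral do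
    rewrite big_ord0 mulr0.
  by rewrite Rintegral_cst// mul0r.
rewrite big_ord_recr/= -IH /weighted_integral.
rewrite -RintegralZl//; last exact: (weighted_integrable (cX n)).
rewrite -RintegralD//; last 2 first.
- exact: (weighted_integrable (cS n)).
- have := integrableZl mD (a n) (weighted_integrable (cX n)).
  by apply: eq_integrable.
by apply: eq_Rintegral => w _; rewrite big_ord_recr/=; ring.
Qed.

End weighted_integral.

Lemma expR_mul1B_le1 (R : realType) (z : R) : expR z * (1 - z) <= 1.
Proof.
have := ler_wpM2l (expR_ge0 z) (expR_ge1Dx (- z)).
by rewrite -expRD subrr expR0.
Qed.

Lemma expR_taylor2 (R : realType) (z : R) :
  `|expR z - 1 - z| <= z ^+ 2 * expR `|z|.
Proof.
have h1 := expR_ge1Dx z; have h3 := expR_mul1B_le1 z.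
have e0 := expR_gt0 z.
rewrite ger0_norm; last by lra.
have [z0|z0] := leP 0 z.
  by rewrite ger0_norm//; nra.
have : 1 <= expR `|z| by rewrite -expR0 ler_expR.
have : expR z <= 1 by rewrite -expR0 ler_expR ltW.
by nra.
Qed.

Section one_step.
Context (R : realType) (alpha beta : R)
  (pi : {sigma_finite_measure set R -> \bar R}) (Phi : R -> R)
  (d : measure_display)
  (T : measurableType d) (P : R -> probability T R) (X : R -> T -> R).
Hypothesis PhiP : is_branching_mechanism alpha beta pi Phi.
Hypothesis HX : CB_process Phi P X.
Implicit Types (x y s t h K e : R) (q : R -> R).

Definition step_functional h y q : R :=
  weighted_integral (P y) setT (fun w => expR (y - X h w)) q.

Definition levy_functional q : R := 2 * beta * q 1 +
  weighted_integral pi `]0, +oo[ (fun theta => expR (- theta)) q.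

Let measurable_step h y : 0 <= h ->
  measurable_fun setT (fun w => expR (y - X h w)).
Proof.
move=> h0; apply: measurableT_comp => //; apply: measurable_funB => //.
exact: CB_measurable HX _ h0.
Qed.

Let step_range h y K : 0 <= h -> y <= K -> forall w,
  setT w -> 0 <= expR (y - X h w) <= expR K.
Proof.
move=> h0 yK w _; rewrite expR_ge0 ler_expR/=.
by have := CB_ge0 HX w h0; lra.
Qed.

Lemma integrable_step h y q : 0 <= h -> continuous q ->
  (P y).-integrable setT (EFin \o fun w => q (expR (y - X h w))).
Proof.
move=> h0 cq.
have [B BP] := continuous_bounded_itv cq (expR_ge0 y).
apply: measurable_bounded_integrable => //.
- by rewrite [X in (X < _)%E](_ : _ = 1%E) ?ltry//; exact: probability_setT.
- exact: measurableT_comp (continuous_measurable_fun cq) (measurable_step y h0).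
- exists B; split; first exact: num_real.
  move=> N BN w _ /=; rewrite (le_trans _ (ltW BN))// BP//.
  exact: step_range.
Qed.

Let integrable_step_weight h y : 0 <= h ->
  (P y).-integrable setT (EFin \o fun w => (1 - expR (y - X h w)) ^+ 2).
Proof.
move=> h0; apply: (@integrable_step _ _ (fun u => (1 - u) ^+ 2)) => //.
have -> : (fun u : R => (1 - u) ^+ 2) = horner ((1 - 'X) ^+ 2).
  by apply/funext => u; rewrite !hornerE.
exact: continuous_horner.
Qed.

Lemma integrable_levy_weight :
  pi.-integrable `]0, +oo[ (EFin \o fun theta => (1 - expR (- theta)) ^+ 2).
Proof.
have [_ levy _ _] := PhiP.
have := integrable_levy_min levy; apply: le_integrable => //.
  apply/measurable_EFinP/measurable_funTS; apply: measurable_funX.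
  apply: measurable_funB => //.
  by apply: measurableT_comp => //; exact: oppr_measurable.
move=> theta /=; rewrite in_itv/= andbT => th0; rewrite lee_fin.
rewrite ger0_norm ?sqr_ge0// ger0_norm ?le_min ?(ltW th0) ?sqr_ge0//.
have h1 : 1 + - theta <= expR (- theta) by exact: expR_ge1Dx.
have h2 : expR (- theta) <= 1 by rewrite -expR0 ler_expR oppr_le0 ltW.
have h3 := expR_gt0 (- theta).
by apply/andP; split; nra.
Qed.

Let measurable_exp_opp :
  measurable_fun `](0 : R), +oo[ (fun theta : R => expR (- theta)).
Proof.
by apply: measurable_funTS; apply: measurableT_comp => //; exact: oppr_measurable.
Qed.

Let exp_opp_range (theta : R) : `](0 : R), +oo[%classic theta -> 0 <= expR (- theta) <= 1.
Proof.
rewrite /= in_itv/= andbT => th0.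
by rewrite expR_ge0 -[leRHS]expR0 ler_expR oppr_le0 ltW.
Qed.

Lemma step_laplace (v : R -> R -> R) (i : nat) h y : 0 <= y -> 0 <= h ->
  'E_(P y)[fun w => expR (- i%:R * X h w)]%E = (expR (- y * v h i%:R))%:E ->
  \int[P y]_w (expR (y - X h w) ^+ i) = expR (y * (i%:R - v h i%:R)).
Proof.
move=> y0 h0 vE.
have -> : \int[P y]_w (expR (y - X h w) ^+ i) =
    \int[P y]_w (expR (y * i%:R) * expR (- i%:R * X h w)).
  apply: eq_Rintegral => w _; rewrite -expRM_natl -expRD; congr expR; ring.
rewrite RintegralZl//.
  have -> : \int[P y]_w expR (- i%:R * X h w) = expR (- y * v h i%:R).
    by move: vE; rewrite unlock /Rintegral => ->.
  by rewrite -expRD; congr expR; ring.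
have := integrableZl measurableT (expR (- (y * i%:R)))
  (@integrable_step h y (fun u => u ^+ i) h0 (@exprn_continuous _ i)).
apply: eq_integrable => // w _ /=; rewrite -EFinM; congr EFin.
by rewrite -expRM_natl -expRD; congr expR; ring.
Qed.

(** With [r = i - v h i], the expectation is [exp (y r)]. The error splits into the Taylor remainder
    of the exponential, quadratic in [y r = O(h)], and [y] times the error of
    [cumulant_expansion]. *)
Lemma step_laplace_expansion (i : nat) K : 0 <= K ->
  exists2 C : R, 0 <= C & forall h y, 0 <= h <= 1 -> 0 <= y <= K ->
    `|\int[P y]_w (expR (y - X h w) ^+ i) - 1 - h * y * Phi i%:R| <= C * h ^+ 2.
Proof.
move=> K0; have [v vP vE] := CB_laplace HX.
have i0 : 0 <= i%:R :> R by exact: ler0n.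
have [C C0 CP] := cumulant_expansion PhiP vP i0.
exists ((K * C) ^+ 2 * expR (K * C) + K * C).
  by rewrite addr_ge0 ?mulr_ge0 ?sqr_ge0 ?expR_ge0.
move=> h y h01 /andP[y0 yK]; have /andP[h0 h1] := h01.
rewrite (step_laplace y0 h0 (vE _ _ _ y0 h0 i0)).
have [r1 r2] := CP h h01; set r := i%:R - v h i%:R in r1 r2 *.
rewrite [X in `|X|](_ : _ = (expR (y * r) - 1 - y * r) + y * (r - h * Phi i%:R));
  last by ring.
rewrite (le_trans (ler_normD _ _))// mulrDl lerD//; last first.
  rewrite normrM ger0_norm// -mulrA ler_pM//.
have yr : `|y * r| <= K * C * h.
  by rewrite normrM ger0_norm// -mulrA ler_pM.
have yr' : `|y * r| <= K * C.
  by rewrite (le_trans yr)// ler_piMr// mulr_ge0.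
rewrite (le_trans (expR_taylor2 _))//.
have -> : (K * C) ^+ 2 * expR (K * C) * h ^+ 2 =
    (K * C * h) ^+ 2 * expR (K * C) by ring.
rewrite ler_pM ?sqr_ge0 ?expR_ge0//.
  rewrite -[leLHS]ger0_norm ?sqr_ge0// normrX lerXn2r ?nnegrE ?normr_ge0//.
  by rewrite !mulr_ge0.
by rewrite ler_expR.
Qed.

(** Expanding [(1 - u)^2 u^j] gives a second difference in the exponent. The affine parts of [Phi],
    namely [alpha l] and the compensator in the kernel, drop out, and [beta l^2] leaves [2 beta]. *)
Lemma levy_functional_monomial (j : nat) :
  levy_functional (fun u => u ^+ j) =
  Phi j%:R - 2 * Phi j.+1%:R + Phi j.+2%:R.
Proof.
have [_ levy PhiE _] := PhiP.
have in0 (i : nat) : i%:R \in `[0 : R, +oo[ by rewrite in_itv/= andbT ler0n.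
rewrite !PhiE// /branching_mechanism /levy_functional /weighted_integral.
have e1 : j.+1%:R = j%:R + 1 :> R by rewrite -natr1.
have e2 : j.+2%:R = j%:R + 2 :> R by rewrite -natr1 e1; ring.
pose k (i : nat) (theta : R) := expR (- i%:R * theta) - 1 + i%:R * theta.
rewrite -/(k j) -/(k j.+1) -/(k j.+2).
have ik i : pi.-integrable `]0, +oo[ (EFin \o k i).
  by apply: integrable_levy_kernel => //; exact: ler0n.
have mpos : measurable (`]0%R, +oo[ : set R) by exact: measurable_itv.
have ikB : pi.-integrable `]0, +oo[ (EFin \o fun theta => k j theta - 2 * k j.+1 theta).
  have := integrableB mpos (ik j) (integrableZl mpos 2 (ik j.+1)).
  by apply: eq_integrable.
have -> : \int[pi]_(theta in `]0, +oo[)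
    ((1 - expR (- theta)) ^+ 2 * expR (- theta) ^+ j) =
    \int[pi]_(theta in `]0, +oo[)
      (k j theta - 2 * k j.+1 theta + k j.+2 theta).
  apply: eq_Rintegral => theta _; rewrite /k.
  have E i : expR (- i%:R * theta) = expR (- theta) ^+ i.
    by rewrite -expRM_natl; congr expR; ring.
  rewrite !E !exprS e1 e2; ring.
have i2 : pi.-integrable `]0, +oo[ (EFin \o fun theta => 2 * k j.+1 theta).
  by have := integrableZl mpos 2 (ik j.+1); apply: eq_integrable.
rewrite (RintegralD mpos ikB (ik _)) (RintegralB mpos (ik _) i2).
rewrite (RintegralZl _ mpos (ik _)).
rewrite expr1n e1 e2; ring.
Qed.

Lemma step_functional_monomial (j : nat) K : 0 <= K ->
  exists2 C : R, 0 <= C & forall h y, 0 <= h <= 1 -> 0 <= y <= K ->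
    `|step_functional h y (fun u => u ^+ j) -
      h * y * levy_functional (fun u => u ^+ j)| <= C * h ^+ 2.
Proof.
move=> K0; have [C0 C00 P0] := step_laplace_expansion j K0.
have [C1 C10 P1] := step_laplace_expansion j.+1 K0.
have [C2 C20 P2] := step_laplace_expansion j.+2 K0.
exists (C0 + 2 * C1 + C2); first by rewrite !addr_ge0// mulr_ge0.
move=> h y h01 yK; have /andP[h0 _] := h01.
rewrite levy_functional_monomial /step_functional /weighted_integral.
pose g (i : nat) w := expR (y - X h w) ^+ i.
have ig i : (P y).-integrable setT (EFin \o g i).
  by apply: (@integrable_step h y (fun u => u ^+ i)) => //; exact: exprn_continuous.
have i2 : (P y).-integrable setT (EFin \o fun w => 2 * g j.+1 w).
  by have := integrableZl measurableT 2 (ig j.+1); apply: eq_integrable.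
have iB : (P y).-integrable setT (EFin \o fun w => g j w - 2 * g j.+1 w).
  by have := integrableB measurableT (ig j) i2; apply: eq_integrable.
have -> : \int[P y]_w ((1 - expR (y - X h w)) ^+ 2 * expR (y - X h w) ^+ j) =
    \int[P y]_w (g j w - 2 * g j.+1 w + g j.+2 w).
  by apply: eq_Rintegral => w _; rewrite /g !exprS; ring.
rewrite (RintegralD measurableT iB (ig _)) (RintegralB measurableT (ig _) i2).
rewrite (RintegralZl _ measurableT (ig _)).
have := P0 h y h01 yK; have := P1 h y h01 yK; have := P2 h y h01 yK.
rewrite -/(g _) !ler_norml => /andP[? ?] /andP[? ?] /andP[? ?].
by apply/andP; split; nra.
Qed.

Lemma step_functional_poly (p : {poly R}) K : 0 <= K ->
  exists2 C : R, 0 <= C & forall h y, 0 <= h <= 1 -> 0 <= y <= K ->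
    `|step_functional h y (horner p) - h * y * levy_functional (horner p)|
      <= C * h ^+ 2.
Proof.
move=> K0.
have pE : horner p = fun u => \sum_(i < size p) p`_i * u ^+ i.
  by apply/funext => u; rewrite horner_coef.
pose C (i : nat) := s2val (cid2 (step_functional_monomial i K0)).
have C0 i : 0 <= C i := s2valP (cid2 (step_functional_monomial i K0)).
have CP i := s2valP' (cid2 (step_functional_monomial i K0)).
exists (\sum_(i < size p) `|p`_i| * C i).
  by apply: sumr_ge0 => i _; rewrite mulr_ge0.
move=> h y h01 yK; have /andP[h0 _] := h01; have /andP[y0 yK'] := yK.
have lE : levy_functional (horner p) =
    \sum_(i < size p) p`_i * levy_functional (fun u => u ^+ i).
  rewrite /levy_functional pE (@weighted_integral_sum _ _ _ _ _ _ 1)//.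
  - rewrite mulr_sumr -big_split/=; apply: eq_bigr => i _; ring.
  - exact: integrable_levy_weight.
rewrite lE /step_functional {1}pE.
rewrite (@weighted_integral_sum _ _ _ _ _ _ (expR K))//; last 3 first.
- exact: measurable_step.
- exact: step_range.
- exact: integrable_step_weight.
rewrite mulr_sumr -sumrB mulr_suml (le_trans (ler_norm_sum _ _ _))//.
apply: ler_sum => i _.
rewrite (_ : _ - _ = p`_i * (step_functional h y (fun u => u ^+ i) -
  h * y * levy_functional (fun u => u ^+ i))); last by rewrite /step_functional; ring.
by rewrite normrM -[leRHS]mulrA ler_wpM2l//; exact: CP.
Qed.

(** Replacing [q] by a polynomial costs [e'] times the mass [step_functional h y (cst 1)]. That mass
    is itself [O(h)], by the expansion for the polynomial 1, so the cost stays small relative to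
    [h]. *)
Lemma step_functional_continuous q K e : continuous q -> 0 <= K -> 0 < e ->
  exists2 h1 : R, 0 < h1 <= 1 & forall h y, 0 <= h <= h1 -> 0 <= y <= K ->
    `|step_functional h y q - h * y * levy_functional q| <= e * h.
Proof.
move=> cq K0 e0.
have [C1 C10 P1] := step_functional_poly 1 K0.
pose c1 := `|levy_functional (cst 1)|.
(* [K c1] is counted twice: once in the mass of the step functional, once for replacing [q] inside
   [levy_functional]. Half of [e] pays for both, the other half for the [O(h^2)] term. *)
pose D := 2 * K * c1 + C1 + 1.
have Kc : 0 <= K * c1 by rewrite mulr_ge0 ?normr_ge0.
have D0 : 0 < D by rewrite /D; lra.
pose e' := e / (2 * D).
have e'0 : 0 < e' by rewrite divr_gt0// mulr_gt0.
have [p pP] := weierstrass cq (expR_gt0 K) e'0.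
have [C C0 CP] := step_functional_poly p K0.
pose h1 := Num.min 1 (e / (2 * (C + 1))).
have h10 : 0 < h1 by rewrite lt_min ltr01 divr_gt0//; lra.
exists h1; first by rewrite h10/= ge_min lexx.
move=> h y /andP[h0 hh1] yK; have /andP[y0 yK'] := yK.
have h01 : 0 <= h <= 1 by rewrite h0 (le_trans hh1)// ge_min lexx.
have hC : C * h <= e / 2.
  have : h <= e / (2 * (C + 1)) by rewrite (le_trans hh1)// ge_min lexx orbT.
  rewrite ler_pdivlMr; last by lra.
  by nra.
have E1 : `|step_functional h y q - step_functional h y (horner p)| <=
    e' * step_functional h y (cst 1).
  apply: (@weighted_integral_dist _ _ _ _ _ _ (expR K)) => //.
  - exact: measurable_step.
  - exact: step_range.
  - exact: integrable_step_weight.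
  - exact: continuous_horner.
have E2 : `|levy_functional q - levy_functional (horner p)| <=
    e' * levy_functional (cst 1).
  have [b0 _ _ _] := PhiP.
  rewrite /levy_functional opprD addrACA -mulrBr [leRHS]mulrDr.
  rewrite (le_trans (ler_normD _ _))// lerD//.
    rewrite normrM (ger0_norm (mulr_ge0 _ b0))// mulr1 mulrC.
    by rewrite ler_wpM2r ?mulr_ge0// pP// ler01 -expR0 ler_expR.
  apply: (@weighted_integral_dist _ _ _ _ _ _ 1) => //.
  - exact: integrable_levy_weight.
  - exact: continuous_horner.
  - by move=> u /andP[u0 u1]; apply: pP; rewrite u0 (le_trans u1)// -expR0 ler_expR.
have E3 := CP h y h01 yK.
have E4 : step_functional h y (cst 1) <= h * (K * c1 + C1).
  have := P1 h y h01 yK.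
  have -> : horner 1 = cst (1 : R) by apply/funext => u; rewrite hornerC.
  rewrite ler_norml => /andP[_].
  have : h * y * levy_functional (cst 1) <= h * (K * c1).
    rewrite -mulrA ler_wpM2l//.
    have h2 : levy_functional (cst 1) <= c1 by exact: ler_norm.
    have c10 : 0 <= c1 by exact: normr_ge0.
    by nra.
  have /andP[_ h_1] := h01.
  have : C1 * h ^+ 2 <= C1 * h by rewrite ler_wpM2l// expr2 ler_piMr.
  by lra.
have E5 : h * y * `|levy_functional q - levy_functional (horner p)| <=
    h * (K * (e' * c1)).
  rewrite -mulrA ler_wpM2l// ler_pM//.
  by rewrite (le_trans E2)// ler_wpM2l ?(ltW e'0)// ler_norm.
rewrite (_ : _ - _ = (step_functional h y q - step_functional h y (horner p)) +
  (step_functional h y (horner p) - h * y * levy_functional (horner p)) -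
  h * y * (levy_functional q - levy_functional (horner p))); last by ring.
rewrite (le_trans (ler_normB _ _))// (le_trans (lerD (ler_normD _ _) (lexx _)))//.
rewrite [X in _ + X <= _]normrM [X in _ + X * _](ger0_norm (mulr_ge0 h0 y0)).
have E6 : e' * step_functional h y (cst 1) <= e' * (h * (K * c1 + C1)).
  by rewrite ler_wpM2l// ltW.
have E7 : e' * D = e / 2.
  by rewrite /e'; field; rewrite gt_eqF.
have E8 : e' * (h * (K * c1 + C1)) + h * (K * (e' * c1)) <= h * (e / 2).
  rewrite -E7 /D; have : 0 <= h * e' by rewrite mulr_ge0// ltW.
  by nra.
have E9 : C * h ^+ 2 <= h * (e / 2) by rewrite expr2 mulrA mulrC ler_wpM2l.
by lra.
Qed.

End one_step.

Lemma EFin_Rintegral d (T : measurableType d) (R : realType)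
    (mu : {measure set T -> \bar R}) (D : set T) (f : T -> R) :
  measurable D -> mu.-integrable D (EFin \o f) ->
  (\int[mu]_(w in D) f w)%:E = (\int[mu]_(w in D) (f w)%:E)%E.
Proof. by move=> mD fi; rewrite /Rintegral fineK//; exact: integrable_fin_num. Qed.

(** * Continuous test functions supported away from 0 *)

Definition bump (R : realType) (a b : R) (f : R -> R) :=
  [/\ continuous f, forall r, 0 <= f r <= 1 & forall r, ~ a < r < b -> f r = 0].

Section bump.
Context (R : realType) (a b : R) (f : R -> R).
Hypotheses (a0 : 0 < a) (fP : bump a b f).

(* In the variable [u = exp (- r)], [f] becomes [(1 - u)^2] times a function
   continuous on the whole line, because [f] vanishes near [r = 0] and near
   [r = +oo]. *)
Definition bump_ratio (u : R) : R := f (- ln u) / (1 - u) ^+ 2.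

Lemma bump_ratioE r : f r = (1 - expR (- r)) ^+ 2 * bump_ratio (expR (- r)).
Proof.
rewrite /bump_ratio expRK opprK; have [_ _ f0] := fP.
have [->|r0] := eqVneq r 0; first by rewrite f0 ?mul0r ?mulr0// => /andP[? ?]; have := a0; lra.
rewrite mulrC divfK// sqrf_eq0 subr_eq0 eq_sym.
by rewrite -expR0 (inj_eq (@expR_inj R)) oppr_eq0.
Qed.

(** Outside [[exp (- b), exp (- a)]] the ratio is locally 0; for [u] in this interval, [0 < u < 1],
    so both the logarithm and the quotient are continuous. *)
Lemma continuous_bump_ratio : continuous bump_ratio.
Proof.
have [cf _ f0] := fP.
have near0 (x : R) : (\near x, bump_ratio x = 0) -> {for x, continuous bump_ratio}.
  move=> nx; rewrite /prop_for /continuous_at (nbhs_singleton nx).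
  have n0 : {near x, cst 0 =1 bump_ratio} by apply: filterS nx => z ->.
  exact: cvg_trans (near_eq_cvg n0) (cvg_cst 0).
move=> u; have [ub|bu] := ltP u (expR (- b)).
  apply: near0; near=> z.
  have zb : z < expR (- b) by near: z; exact: lt_nbhsl.
  rewrite /bump_ratio f0 ?mul0r//; have [z0|z0] := leP z 0.
    (* For [z <= 0] the logarithm takes its default value 0, and [f] vanishes at 0. *)
    by rewrite ln0// => /andP[? ?]; have := a0; lra.
  have : ln z < - b by rewrite -[ltRHS]expRK ltr_ln ?posrE ?expR_gt0.
  by move=> ? /andP[? ?]; lra.
have u0 : 0 < u by exact: lt_le_trans (expR_gt0 _) bu.
have [ua|au] := ltP (expR (- a)) u.
  apply: near0; near=> z.
  have za : expR (- a) < z by near: z; exact: lt_nbhsr.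
  have z0 : 0 < z by exact: lt_trans (expR_gt0 _) za.
  rewrite /bump_ratio f0 ?mul0r//.
  have : - a < ln z by rewrite -[ltLHS]expRK ltr_ln ?posrE ?expR_gt0.
  by move=> ? /andP[? ?]; lra.
have u1 : u < 1 by rewrite (le_lt_trans au)// -[ltRHS]expR0 ltr_expR oppr_lt0.
apply: (@cvgM _ _ _ _ (fun u => f (- ln u)) (fun u => ((1 - u) ^+ 2)^-1)).
  apply: (@continuous_comp _ _ _ (fun u => - ln u) f); last exact: cf.
  by apply: cvgN; exact: continuous_ln.
apply: cvgV; first by rewrite sqrf_eq0 subr_eq0 eq_sym lt_eqF.
have sqE : (fun z : R => (1 - z) ^+ 2) = horner ((1 - 'X) ^+ 2).
  by apply/funext => z; rewrite !hornerE.
have := @continuous_horner _ ((1 - 'X) ^+ 2 : {poly R}) u.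
by rewrite /continuous_at -sqE.
Unshelve. all: end_near. Qed.

End bump.

(** * Rate of jumps and killed exponentials over one step *)

Section one_step_bounds.
Context (R : realType) (alpha beta : R)
  (pi : {sigma_finite_measure set R -> \bar R}) (Phi : R -> R)
  (d : measure_display)
  (T : measurableType d) (P : R -> probability T R) (X : R -> T -> R).
Hypothesis PhiP : is_branching_mechanism alpha beta pi Phi.
Hypothesis HX : CB_process Phi P X.
Implicit Types (x y s t h K e : R) (q : R -> R).

Section jump_rate.
Variables (a b : R) (f : R -> R).
Hypotheses (a0 : 0 < a) (fP : bump a b f).

Let cq := continuous_bump_ratio a0 fP.
Let fE := bump_ratioE a0 fP.

Lemma integrable_levy_bump : pi.-integrable `]0, +oo[ (EFin \o f).
Proof.
have mpos : measurable (`]0%R, +oo[ : set R) by exact: measurable_itv.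
have mexp : measurable_fun (`]0%R, +oo[ : set R) (fun theta : R => expR (- theta)).
  by apply: measurable_funTS; apply: measurableT_comp => //; exact: oppr_measurable.
have w01 (theta : R) : `](0 : R), +oo[%classic theta -> 0 <= expR (- theta) <= 1.
  rewrite /= in_itv/= andbT => th0.
  by rewrite expR_ge0 -[leRHS]expR0 ler_expR oppr_le0 ltW.
have := @weighted_integrable _ _ _ _ _ _ 1 mpos mexp ler01 w01
  (integrable_levy_weight PhiP) _ cq.
by apply: eq_integrable => // theta _ /=; rewrite -fE.
Qed.

Lemma integral_levy_bump :
  (\int[pi]_r (f r)%:E = (\int[pi]_(r in `]0%R, +oo[) f r)%R%:E)%E.
Proof.
rewrite EFin_Rintegral//; last exact: integrable_levy_bump.
rewrite [RHS]integral_mkcond; apply: eq_integral => r _.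
rewrite /patch; case: ifPn => //; rewrite notin_setE /= in_itv/= andbT.
move=> r0; have [_ _ ->//] := fP; move=> /andP[ar _]; apply: r0; have := a0; lra.
Qed.

Lemma integrable_bump h y : 0 <= h ->
  (P y).-integrable setT (EFin \o fun w => f (X h w - y)).
Proof.
move=> h0; have [cf f01 _] := fP.
apply: measurable_bounded_integrable => //.
- by rewrite [X in (X < _)%E](_ : _ = 1%E) ?ltry//; exact: probability_setT.
- apply: measurableT_comp; first exact: continuous_measurable_fun.
  by apply: measurable_funB => //; exact: CB_measurable HX _ h0.
- exists 1; split; first exact: num_real.
  move=> N N1 w _ /=; have /andP[? ?] := f01 (X h w - y).
  by rewrite ger0_norm//; lra.
Qed.

Lemma jump_rate K e : 0 <= K -> 0 < e ->
  exists2 h1 : R, 0 < h1 <= 1 & forall h y, 0 <= h <= h1 -> 0 <= y <= K ->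
    `|\int[P y]_w f (X h w - y) - h * y * \int[pi]_(r in `]0, +oo[) f r| <= e * h.
Proof.
move=> K0 e0.
have [h1 h1P H] := step_functional_continuous PhiP HX cq K0 e0.
exists h1 => // h y hh yK; have := H h y hh yK.
have -> : step_functional P X h y (bump_ratio f) = \int[P y]_w f (X h w - y).
  by apply: eq_Rintegral => w _; rewrite fE opprB.
suff -> : levy_functional beta pi (bump_ratio f) =
    \int[pi]_(r in `]0, +oo[) f r by [].
(* The term in [beta] disappears: [bump_ratio 1] has numerator [f 0 = 0]. *)
rewrite /levy_functional {1}/bump_ratio ln1 oppr0.
have [_ _ ->] := fP; last by move=> /andP[? ?]; have := a0; lra.
rewrite mul0r mulr0 add0r; apply: eq_Rintegral => r _.
by rewrite -fE.
Qed.

End jump_rate.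

Lemma expR_bernoulli (mu z : R) : 1 <= mu -> 1 + mu * (expR z - 1) <= expR (mu * z).
Proof.
move=> mu1; have -> : mu * z = z + (mu - 1) * z by ring.
rewrite expRD; have h1 := expR_ge1Dx ((mu - 1) * z).
have e0 := expR_gt0 z; have h3 := expR_mul1B_le1 z.
have : expR z * (1 + (mu - 1) * z) <= expR z * expR ((mu - 1) * z).
  by rewrite ler_pM2l.
have : 0 <= (mu - 1) * (1 - expR z * (1 - z)) by rewrite mulr_ge0//; lra.
lra.
Qed.

Lemma expR_dist1 (z : R) : `|expR z - 1| <= `|z| * expR `|z|.
Proof.
have h1 := expR_ge1Dx z; have h3 := expR_mul1B_le1 z.
have e0 := expR_gt0 z.
have [z0|z0] := leP 0 z; first by rewrite (ger0_norm z0) ger0_norm//; lra.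
have : 1 <= expR `|z| by rewrite -expR0 ler_expR.
have : expR z <= 1 by rewrite -expR0 ler_expR ltW.
rewrite (ltr0_norm z0) => h4 h5; rewrite ler0_norm; last by lra.
have : - z * 1 <= - z * expR (- z) by rewrite ler_wpM2l//; lra.
lra.
Qed.

(* With [U = exp (y - X h)], Bernoulli's inequality bounds
   [exp (- mu (X h - y))], truncated to [X h - y <= a], below by
   [1 + mu (U - 1) - ca (1 - U)^2], of expectation [1 - O(mu h y)]. When [h y]
   is not small, the left-hand side is itself [O(h^2)]. *)
Lemma small_increment_laplace (a : R) : 0 < a ->
  exists2 C : R, 0 <= C & forall M : R, exists2 C' : R, 0 <= C' &
    forall h y mu, 0 <= h <= 1 -> 0 <= y -> 1 <= mu <= M ->
    ((expR (- (mu * (1 + C * h)) * y))%:E <=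
     \int[P y]_w (((X h w - y <= a)%R%:R * expR (- mu * X h w))%R)%:E +
       (C' * h ^+ 2)%R%:E)%E.
Proof.
move=> a0; have [v vP vE] := CB_laplace HX.
have [C1 C10 CP1] := cumulant_expansion PhiP vP (ler0n _ 1).
have [C2 C20 CP2] := cumulant_expansion PhiP vP (ler0n _ 2).
pose B1 := C1 * expR C1; pose B2 := C2 * expR C2.
have B10 : 0 <= B1 by rewrite mulr_ge0 ?expR_ge0.
have B20 : 0 <= B2 by rewrite mulr_ge0 ?expR_ge0.
have ea : expR (- a) < 1 by rewrite -[ltRHS]expR0 ltr_expR oppr_lt0.
(* For an increment above [a], [U <= exp (- a)], hence [ca (1 - U)^2 >= 1]; this makes the minorant
   nonpositive where the truncated exponential is 0. *)
pose ca := ((1 - expR (- a)) ^+ 2)^-1.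
have ca0 : 0 < ca by rewrite invr_gt0 exprn_gt0// subr_gt0.
pose C := B1 + ca * (2 * B1 + B2).
have C0 : 0 <= C by rewrite addr_ge0// mulr_ge0 ?(ltW ca0)// addr_ge0// mulr_ge0.
exists (2 * C); first by rewrite mulr_ge0.
(* [C] is fixed before [M]: the iteration over the grid takes [M = exp (C t)]. Only the additive
   error [C'] may depend on [M]. *)
move=> M; pose N := Num.max 1 M.
have N1 : 1 <= N by rewrite le_max lexx.
pose c0 := (1 + 2 * C * N)^-1.
have CN : 0 <= 2 * C * N by rewrite !mulr_ge0//; lra.
(* [c0] is the threshold for [y h]. Below it, [z = C mu y h] is at most 1/2, so
   [exp (- 2 z) <= 1 - z]; this is the origin of the factor 2 in [2 C]. Above it,
   [exp (- y) <= 4 / y^2 <= 4 h^2 / c0^2]. *)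
have c00 : 0 < c0 by rewrite invr_gt0; lra.
exists (4 / c0 ^+ 2); first by rewrite divr_ge0 ?sqr_ge0.
move=> h y mu h01 y0 /andP[mu1 muM]; have /andP[h0 h1] := h01.
have muN : mu <= N by rewrite le_max muM orbT.
pose g w := (X h w - y <= a)%R%:R * expR (- mu * X h w).
have g0 w : 0 <= g w by rewrite mulr_ge0// expR_ge0.
have mXh : measurable_fun setT (X h) by exact: CB_measurable HX _ h0.
have mg : measurable_fun setT g.
  apply: measurable_funM.
    apply: (@measurableT_comp _ _ _ _ _ _ (fun b : bool => b%:R : R)) => //.
    apply: measurable_fun_ler => //; exact: measurable_funB.
  apply: measurableT_comp => //; exact: measurable_funM.
have [yh|yh] := leP (y * h) c0; last first.
  have ylarge : expR (- (mu * (1 + 2 * C * h)) * y) <= 4 / c0 ^+ 2 * h ^+ 2.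
    have h00 : 0 < h.
      rewrite lt_neqAle h0 andbT; apply/negP => /eqP h00.
      by move: yh; rewrite -h00 mulr0 ltNge (ltW c00).
    have yp : c0 / h < y by rewrite ltr_pdivrMr.
    have y00 : 0 < y by apply: lt_trans yp; rewrite divr_gt0.
    apply: (@le_trans _ _ (expR (- y))).
      rewrite ler_expR mulNr lerN2 ler_peMl//.
      have : 0 <= 2 * C * h by rewrite !mulr_ge0.
      by nra.
    have ey : y ^+ 2 / 4 <= expR y.
      have -> : y = y / 2 + y / 2 by lra.
      rewrite expRD; have := expR_ge1Dx (y / 2).
      have : 0 < y / 2 by rewrite divr_gt0.
      by nra.
    have cyh : c0 ^+ 2 <= (y * h) ^+ 2.
      by rewrite lerXn2r ?nnegrE ?(ltW yh) ?(ltW c00)// mulr_ge0.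
    rewrite expRN; apply: (@le_trans _ _ (y ^+ 2 / 4)^-1).
      by rewrite lef_pV2 ?posrE ?expR_gt0// divr_gt0 ?exprn_gt0.
    rewrite invf_div ler_pdivrMr ?exprn_gt0//.
    have -> : 4 / c0 ^+ 2 * h ^+ 2 * y ^+ 2 = 4 * ((y * h) ^+ 2 / c0 ^+ 2).
      by field; rewrite gt_eqF.
    by rewrite ler_pMr// ler_pdivlMr ?exprn_gt0// mul1r.
  rewrite -[leLHS]add0e leeD ?lee_fin//.
  by apply: integral_ge0 => w _; rewrite lee_fin; exact: g0.
have mufin : (P y setT < +oo)%E.
  by rewrite [X in (X < _)%E](_ : _ = 1%E) ?ltry//; exact: probability_setT.
have ig : (P y).-integrable setT (EFin \o g).
  apply: measurable_bounded_integrable => //.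
  exists 1; split; first exact: num_real.
  move=> N' N1' w _ /=; rewrite ger0_norm//.
  rewrite (@le_trans _ _ 1) ?(ltW N1')// /g -[leRHS]mulr1 ler_pM ?expR_ge0//.
    by rewrite lern1 leq_b1.
  rewrite -expR0 ler_expR mulNr oppr_le0 mulr_ge0//; first by lra.
  exact: CB_ge0 HX _ _ h0.
rewrite -EFin_Rintegral// -EFinD lee_fin.
pose U i w := expR (y - X h w) ^+ i.
have iU i : (P y).-integrable setT (EFin \o U i).
  by apply: (@integrable_step _ _ _ _ _ _ HX h y (fun u => u ^+ i)) => //;
    exact: exprn_continuous.
have EU (i : nat) : \int[P y]_w U i w = expR (y * (i%:R - v h i%:R)).
  by apply: (step_laplace HX) => //; exact: vE.
have iZ r i : (P y).-integrable setT (EFin \o fun w => r * U i w).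
  by have := integrableZl measurableT r (iU i); apply: eq_integrable.
pose L w := (1 - mu - ca) * U 0%N w + (mu + 2 * ca) * U 1%N w.
have iL : (P y).-integrable setT (EFin \o L).
  by have := integrableD measurableT (iZ (1 - mu - ca) 0%N) (iZ (mu + 2 * ca) 1%N);
    apply: eq_integrable.
have iLB : (P y).-integrable setT (EFin \o fun w => L w - ca * U 2%N w).
  by have := integrableB measurableT iL (iZ ca 2%N); apply: eq_integrable.
have pointwise w : expR (- mu * y) * (L w - ca * U 2%N w) <= g w.
  have -> : L w - ca * U 2%N w =
      1 + mu * (U 1%N w - 1) - ca * (1 - U 1%N w) ^+ 2.
    by rewrite /L /U expr0 expr1; ring.
  have Ule : 0 <= ca * (1 - U 1%N w) ^+ 2 by rewrite mulr_ge0 ?sqr_ge0// ltW.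
  rewrite /g; case: (leP (X h w - y) a) => xa.
    rewrite mul1r (_ : - mu * X h w = - mu * y + mu * (y - X h w)); last by ring.
    rewrite expRD ler_wpM2l ?expR_ge0//.
    have := expR_bernoulli (y - X h w) mu1.
    by move: Ule; rewrite /U expr1; lra.
  rewrite mul0r pmulr_rle0 ?expR_gt0//.
  have U1 : U 1%N w <= expR (- a) by rewrite /U expr1 ler_expR; lra.
  have : 1 <= ca * (1 - U 1%N w) ^+ 2.
    rewrite /ca mulrC ler_pdivlMr ?exprn_gt0 ?subr_gt0// mul1r.
    by rewrite lerXn2r ?nnegrE//; lra.
  have : mu * (1 - U 1%N w) >= 0 by rewrite mulr_ge0//; lra.
  lra.
have main : expR (- mu * y) * \int[P y]_w (L w - ca * U 2%N w) <= \int[P y]_w g w.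
  rewrite -RintegralZl//; apply: le_Rintegral => //.
  by have := integrableZl measurableT (expR (- mu * y)) iLB; apply: eq_integrable.
rewrite -lerBlDr; apply: le_trans main.
rewrite RintegralB// RintegralD// !RintegralZl// !EU.
have [r1 _] := CP1 h h01; have [r2 _] := CP2 h h01.
have -> : expR (y * (0%:R - v h 0%:R)) = 1.
  rewrite -(EU 0%N); under eq_Rintegral do rewrite /U expr0.
  by rewrite Rintegral_cst// mul1r [X in fine X](_ : _ = 1%E)//; exact: probability_setT.
have c01 : c0 <= 1 by rewrite invf_le1; lra.
have yh0 : 0 <= y * h by rewrite mulr_ge0.
have bnd (Ci r : R) : 0 <= Ci -> `|r| <= Ci * h ->
    `|expR (y * r) - 1| <= Ci * expR Ci * (y * h).
  move=> Ci0 rC; have yr : `|y * r| <= Ci * (y * h).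
    by rewrite normrM ger0_norm// mulrCA ler_wpM2l.
  rewrite (le_trans (expR_dist1 _))// mulrAC ler_pM ?expR_ge0//.
  by rewrite ler_expR (le_trans yr)// ler_piMr// (le_trans yh).
have := bnd _ _ C10 r1; have := bnd _ _ C20 r2; rewrite -/B1 -/B2.
set E1 := expR (y * (1 - _)); set E2 := expR (y * _).
rewrite !ler_norml => /andP[_ e2] /andP[e1 e1'].
have lin : 1 - C * mu * (y * h) <=
    (1 - mu - ca) * 1 + (mu + 2 * ca) * E1 - ca * E2.
  rewrite /C.
  have : ca * (E2 - 1) <= ca * (B2 * (y * h)) by rewrite ler_wpM2l// ltW.
  have : (mu + 2 * ca) * (1 - E1) <= (mu + 2 * ca) * (B1 * (y * h)).
    by rewrite ler_wpM2l//; lra.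
  (* The terms in [ca] come without a factor [mu]; [mu >= 1] lets [C mu] absorb them. *)
  have : 0 <= (mu - 1) * (ca * (2 * B1 + B2) * (y * h)).
    rewrite !mulr_ge0//; [lra|exact: ltW|lra].
  lra.
apply: (@le_trans _ _ (expR (- mu * y) * (1 - C * mu * (y * h)))); last first.
  by rewrite ler_wpM2l ?expR_ge0.
rewrite lerBlDr.
have -> : - (mu * (1 + 2 * C * h)) * y = - mu * y + - (2 * (C * mu * (y * h))).
  by ring.
rewrite expRD; set z := C * mu * (y * h).
have z0 : 0 <= z by rewrite !mulr_ge0//; lra.
have z1 : z <= 1 / 2.
  have : C * mu * (y * h) <= C * N * c0 by rewrite !ler_pM// ?mulr_ge0//; lra.
  have : (1 + 2 * C * N) * c0 = 1 by rewrite mulfV// gt_eqF//; lra.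
  rewrite -/z; lra.
have ez : expR (- (2 * z)) <= 1 - z.
  rewrite expRN; have := expR_ge1Dx (2 * z) => h2.
  have e0 := expR_gt0 (2 * z).
  rewrite -[leLHS]mul1r ler_pdivrMr//.
  by nra.
have : expR (- mu * y) * expR (- (2 * z)) <= expR (- mu * y) * (1 - z).
  by rewrite ler_wpM2l ?expR_ge0.
have : 0 <= 4 / c0 ^+ 2 * h ^+ 2 by rewrite mulr_ge0 ?sqr_ge0// divr_ge0 ?sqr_ge0.
lra.
Qed.

End one_step_bounds.

(** * Increments along a grid *)

Section chain.
Context (R : realType) (Phi : R -> R) (d : measure_display)
  (T : measurableType d) (P : R -> probability T R) (X : R -> T -> R).
Hypothesis HX : CB_process Phi P X.
Implicit Types (x y s t h K e a mu : R) (A B : set T) (i j k m n : nat).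

Definition small_increments a h i j : set T :=
  [set w | forall k, (i <= k < j)%N -> X (k.+1%:R * h) w - X (k%:R * h) w <= a].

Lemma small_incrementsS a h i j : (i <= j)%N ->
  small_increments a h i j.+1 =
  small_increments a h i j `&`
    [set w | X (j.+1%:R * h) w - X (j%:R * h) w <= a].
Proof.
move=> ij; apply/seteqP; split => w /=.
  move=> H; split; last by apply: H; rewrite ij /=.
  by move=> k /andP[ik kj]; apply: H; rewrite ik /= ltnS ltnW.
move=> [H1 H2] k /andP[ik]; rewrite ltnS leq_eqVlt => /predU1P[->//|kj].
by apply: H1; rewrite ik.
Qed.

Lemma small_incrementsnn a h i : small_increments a h i i = setT.
Proof.
apply/seteqP; split => // w _ k /andP[ik]; rewrite ltnNge ik//.
Qed.

Let grid_le h k j : 0 <= h -> (k <= j)%N -> 0 <= k%:R * h <= j%:R * h.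
Proof. by move=> h0 kj; rewrite mulr_ge0//= ler_wpM2r// ler_nat. Qed.

Lemma natural_filtration_small a h i j : 0 <= h -> (i <= j)%N ->
  natural_filtration X (j%:R * h) (small_increments a h i j).
Proof.
move=> h0 ij; rewrite -(subnKC ij); move: (j - i)%N => m.
elim: m => [|m IH]; first by rewrite addn0 small_incrementsnn;
  exact: natural_filtration_setT.
rewrite addnS small_incrementsS ?leq_addr//; apply: natural_filtrationI.
  apply: natural_filtration_le IH.
  by have /andP[_] := grid_le h0 (leqnSn (i + m)).
rewrite (_ : [set _ | _] = (fun w => X ((i + m).+1%:R * h) w -
    X ((i + m)%:R * h) w) @^-1` `]-oo, a]%classic); last first.
  by apply/seteqP; split => w /=; rewrite in_itv.
apply: natural_filtration_increment; first exact: grid_le.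
- exact: grid_le.
- exact: measurable_itv.
Qed.

Lemma measurable_X t : 0 <= t -> measurable_fun setT (X t).
Proof. by move=> t0; exact: CB_measurable HX _ t0. Qed.

Lemma measurable_X_exp mu t : 0 <= t ->
  measurable_fun setT (fun w => expR (- mu * X t w)).
Proof.
move=> t0; apply: measurableT_comp => //; apply: measurable_funM => //.
exact: measurable_X.
Qed.

Lemma small_increment_step x s h a mu nu e A :
  0 <= x -> 0 <= s -> 0 <= h -> 0 <= e -> natural_filtration X s A ->
  (forall y, 0 <= y -> ((expR (- nu * y))%:E <=
     \int[P y]_w (((X h w - y <= a)%R%:R * expR (- mu * X h w))%R)%:E +
       e%:E)%E) ->
  (\int[P x]_(w in A) (expR (- nu * X s w))%:E <=
   \int[P x]_(w in A `&` [set w | (X (s + h) w - X s w <= a)%R])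
     (expR (- mu * X (s + h) w))%R%:E + e%:E * P x A)%E.
Proof.
move=> x0 s0 h0 e0 As H.
have mA := natural_filtration_measurable HX As.
pose g (z : R * R) : \bar R := (((z.2 - z.1 <= a)%R%:R * expR (- mu * z.2))%R)%:E.
have mg : measurable_fun setT g.
  apply: measurableT_comp => //; apply: measurable_funM.
    apply: (@measurableT_comp _ _ _ _ _ _ (fun b : bool => b%:R : R)) => //.
    by apply: measurable_fun_ler => //; exact: measurable_funB.
  apply: measurableT_comp => //; exact: measurable_funM.
have g0 z : (0 <= g z)%E by rewrite lee_fin mulr_ge0// expR_ge0.
have sh0 : 0 <= s + h by rewrite addr_ge0.
have -> : (\int[P x]_(w in A `&` [set w | (X (s + h) w - X s w <= a)%R])
     (expR (- mu * X (s + h) w))%R%:E =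
   \int[P x]_(w in A) g (X s w, X (s + h)%R w))%E.
  rewrite integral_mkcondr; apply: eq_integral => w _; rewrite /patch /g /=.
  case: ifPn => [|]; first by rewrite inE /= => ->; rewrite mul1r.
  by rewrite notin_setE /= => /negP/negbTE ->; rewrite mul0r.
rewrite (markov_integral HX x0 s0 h0 As mg g0) -integral_cst//.
have mG : measurable_fun A (fun w => \int[P (X s w)]_z g (X s w, X h z))%E.
  by apply: measurable_funTS; exact: (measurable_markov_integral HX s0 h0).
rewrite -ge0_integralD//; last by move=> w _; exact: integral_ge0.
apply: ge0_le_integral => //.
- apply/measurable_EFinP/measurable_funTS; exact: measurable_X_exp.
- exact: emeasurable_funD.
- by move=> w _; apply: H; exact: CB_ge0 HX _ _ s0.
Qed.

(** The exponent is propagated backwards in time: it is [mu] at the last step, and each earlier step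
    multiplies it by [1 + C h]. Each step adds an error [C' h^2] weighted by the probability of an
    event inside [B]; [M] keeps every exponent in the admissible range. *)
Lemma small_increments_laplace x h a C C' M i m mu B :
  0 <= x -> 0 <= h <= 1 -> 0 <= C -> 0 <= C' ->
  (forall h y mu, 0 <= h <= 1 -> 0 <= y -> 1 <= mu <= M ->
    ((expR (- (mu * (1 + C * h)) * y))%:E <=
     \int[P y]_w (((X h w - y <= a)%R%:R * expR (- mu * X h w))%R)%:E +
       (C' * h ^+ 2)%R%:E)%E) ->
  natural_filtration X (i%:R * h) B ->
  1 <= mu -> mu * (1 + C * h) ^+ m <= M ->
  (\int[P x]_(w in B) (expR (- (mu * (1 + C * h) ^+ m) * X (i%:R * h) w))%R%:E <=
   \int[P x]_(w in B `&` small_increments a h i (i + m))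
     (expR (- mu * X ((i + m)%:R * h) w))%R%:E +
   (m%:R * C' * h ^+ 2)%R%:E * P x B)%E.
Proof.
move=> x0 h01 C0 C'0 H Bi; have /andP[h0 h1] := h01.
have Ch : 1 <= 1 + C * h by rewrite lerDl mulr_ge0.
have mB := natural_filtration_measurable HX Bi.
elim: m mu => [|m IH] mu mu1 muM.
  by rewrite expr0 mulr1 addn0 small_incrementsnn setIT !mul0r mul0e adde0.
have mu'1 : 1 <= mu * (1 + C * h) by rewrite -[leLHS]mulr1 ler_pM.
have muM' : mu <= M.
  by rewrite (le_trans _ muM)// ler_peMr// ?exprn_ege1//; lra.
have := IH (mu * (1 + C * h)); rewrite -mulrA -exprS => /(_ mu'1 muM) IH1.
apply: (le_trans IH1).
have im0 : 0 <= (i + m)%:R * h by rewrite mulr_ge0.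
have hSE : (i + m)%:R * h + h = (i + m.+1)%:R * h.
  by rewrite addnS -[in RHS]natr1; ring.
have nfA : natural_filtration X ((i + m)%:R * h)
    (B `&` small_increments a h i (i + m)).
  apply: natural_filtrationI.
    apply: natural_filtration_le Bi.
    by have /andP[_] := grid_le h0 (leq_addr m i).
  by apply: natural_filtration_small; rewrite ?leq_addr.
have mA := natural_filtration_measurable HX nfA.
have e0 : 0 <= C' * h ^+ 2 by rewrite mulr_ge0 ?sqr_ge0.
have muM1 : 1 <= mu <= M by rewrite mu1.
have Hmu (y : R) (y0 : 0 <= y) := H h y mu h01 y0 muM1.
have := small_increment_step x0 im0 h0 e0 nfA Hmu.
rewrite hSE => step.
apply: (@le_trans _ _ (\int[P x]_(w in B `&` small_increments a h i (i + m.+1))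
     (expR (- mu * X ((i + m.+1)%:R * h) w))%R%:E +
     (C' * h ^+ 2)%:E * P x B + (m%:R * C' * h ^+ 2)%R%:E * P x B)%E).
  rewrite leeD2r// (le_trans step)//; apply: leeD.
    rewrite -setIA addnS -small_incrementsS ?leq_addr//.
  by rewrite lee_wpmul2l ?lee_fin// le_measure ?inE//; exact: subIsetl.
rewrite -addeA leeD2l// -ge0_muleDl ?lee_fin//; last first.
  by rewrite -mulrA mulr_ge0.
rewrite -EFinD lee_wpmul2r// lee_fin -[in leRHS]natr1.
by rewrite -!mulrA mulrDl mul1r addrC.
Qed.

End chain.

(** * Law of the largest jump dominated by the Levy measure *)

Definition image_measure d1 d2 (T1 : measurableType d1) (T2 : measurableType d2)
    (R : realType) (mu : {measure set T1 -> \bar R}) (D : set T1)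
    (mD : measurable D) (f : T1 -> T2) (mf : measurable_fun setT f) :
    {measure set T2 -> \bar R} :=
  measure_function_pushforward__canonical__measure_function_Measure
    (mrestr mu mD) mf.

Lemma image_measureE d1 d2 (T1 : measurableType d1) (T2 : measurableType d2)
    (R : realType) (mu : {measure set T1 -> \bar R}) (D : set T1)
    (mD : measurable D) (f : T1 -> T2) (mf : measurable_fun setT f) (B : set T2) :
  image_measure mu mD mf B = mu (D `&` f @^-1` B).
Proof. by rewrite setIC. Qed.

Lemma ge0_integral_image_measure d1 d2 (T1 : measurableType d1)
    (T2 : measurableType d2) (R : realType) (mu : {measure set T1 -> \bar R})
    (D : set T1) (mD : measurable D) (f : T1 -> T2)
    (mf : measurable_fun setT f) (g : T2 -> \bar R) :
  measurable_fun setT g -> (forall r, 0 <= g r)%E ->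
  (\int[image_measure mu mD mf]_r g r = \int[mu]_(w in D) g (f w))%E.
Proof.
move=> mg g0; rewrite -(@ge0_integral_mrestr _ _ _ _ _ mD (g \o f))//.
- exact: ge0_integral_pushforward.
- exact: measurableT_comp.
- by move=> w; exact: g0.
Qed.

Lemma max_incrementE (R : realType) (x : R -> R) (t : R) (n : nat) :
  max_increment x t n =
  \big[Num.max/0]_(k < n) (x (k.+1%:R * (t / n%:R)) - x (k%:R * (t / n%:R))).
Proof.
apply: eq_bigr => k _; congr (x _ - x _); first by rewrite mulrA [_ * t]mulrC.
by rewrite mulrA [_ * t]mulrC.
Qed.

(** The maximum is 0 or one of the [xi k], so it suffices to compare with a single term; the
    induction carries nonnegativity of the sum along. *)
Lemma bigmax_le_sum (R : realType) (f : R -> R) (n : nat) (xi : 'I_n -> R) :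
  (forall r, 0 <= f r) -> f 0 = 0 ->
  f (\big[Num.max/0]_(k < n) xi k) <= \sum_(k < n) f (xi k).
Proof.
move=> f0 f00.
suff : f (\big[Num.max/0]_(k < n) xi k) <= \sum_(k < n) f (xi k) /\
    0 <= \sum_(k < n) f (xi k) by case.
apply: (big_ind2 (fun m s => f m <= s /\ 0 <= s)).
- by rewrite f00.
- move=> m1 s1 m2 s2 [h1 h2] [h3 h4]; split; last exact: addr_ge0.
  by case: (leP m1 m2) => _; lra.
- by move=> k _; split.
Qed.

Lemma measurable_bigmax d (T : measurableType d) (R : realType) (I : Type)
    (r : seq I) (F : I -> T -> R) : (forall i, measurable_fun setT (F i)) ->
  measurable_fun setT (fun w => \big[Num.max/0]_(i <- r) F i w).
Proof.
move=> mF; elim: r => [|i r IH].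
  by under eq_fun do rewrite big_nil; exact: measurable_cst.
rewrite (_ : (fun w => _) =
    F i \max (fun w => \big[Num.max/0]_(i <- r) F i w)).
  exact: measurable_maxr.
by apply/funext => w; rewrite big_cons.
Qed.

Section sup_jump_law.
Context (R : realType) (alpha beta : R)
  (pi : {sigma_finite_measure set R -> \bar R}) (Phi : R -> R)
  (d : measure_display)
  (T : measurableType d) (P : R -> probability T R) (X : R -> T -> R).
Hypothesis PhiP : is_branching_mechanism alpha beta pi Phi.
Hypothesis HX : CB_process Phi P X.
Implicit Types (x y s t h K e : R).

Lemma measurable_max_increment t n : 0 <= t ->
  measurable_fun setT (fun w => max_increment (X ^~ w) t n).
Proof.
move=> t0; apply: measurable_bigmax => k; apply: measurable_funB;
  by apply: (measurable_X HX); rewrite divr_ge0// mulr_ge0.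
Qed.

Lemma measurable_sup_jump t : 0 < t ->
  measurable_fun setT (fun w => sup_jump (X ^~ w) t).
Proof.
move=> t0; apply: (@measurable_fun_cvg _ _ _ _
    (fun n w => max_increment (X ^~ w) t n)).
  by move=> n; apply: measurable_max_increment; exact: ltW.
by move=> w _; apply: max_increment_cvg => //; exact: CB_rcll HX w.
Qed.

Lemma integral_max_increment_cvg x t (E : set T) (f : R -> R) : 0 < t ->
  measurable E -> continuous f -> (forall r, 0 <= f r <= 1) ->
  (\int[P x]_(w in E) (f (max_increment (X ^~ w) t n))%:E @[n --> \oo] -->
   \int[P x]_(w in E) (f (sup_jump (X ^~ w) t))%:E)%E.
Proof.
move=> t0 mE cf f01; have mf := continuous_measurable_fun cf.
apply: (@dominated_cvg _ _ _ _ _ mE _ _ (cst 1%E)) => //.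
- move=> n; apply/measurable_EFinP/measurable_funTS.
  by apply: measurableT_comp => //; apply: measurable_max_increment; exact: ltW.
- move=> w _; apply: cvg_EFin; first by near=> n.
  exact: (cvg_comp _ _ (max_increment_cvg (CB_rcll HX w) t0) (cf _)).
- exact: finite_measure_integrable_cst.
- move=> n w _; have /andP[? ?] := f01 (max_increment (X ^~ w) t n).
  by rewrite /= ger0_norm// lee_fin.
Unshelve. all: end_near. Qed.

Lemma step_bump_upper x s h K (I : R) e (f : R -> R) : 0 <= x -> 0 <= s -> 0 <= h ->
  0 <= K -> 0 <= I -> 0 <= e -> (forall r, 0 <= f r) -> continuous f ->
  (forall y, (0 <= y <= K)%R ->
    \int[P y]_w (f (X h w - y)%R)%:E <= (h * y * I + e * h)%R%:E)%E ->
  (\int[P x]_(w in [set w | (X s w <= K)%R]) (f (X (s + h) w - X s w)%R)%:E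
    <= (h * (K * I + e))%:E)%E.
Proof.
move=> x0 s0 h0 K0 I0 e0 f0 cf H; have mf := continuous_measurable_fun cf.
have AE : [set w | (X s w <= K)%R] = X s @^-1` `]-oo, K]%classic.
  by apply/seteqP; split => w /=; rewrite in_itv.
have As : natural_filtration X s [set w | (X s w <= K)%R].
  by rewrite AE; apply: natural_filtration_preimage => //; rewrite s0 lexx.
have mA := natural_filtration_measurable HX As.
have mg : measurable_fun setT (fun z : R * R => (f (z.2 - z.1))%:E).
  apply/measurable_EFinP; apply: measurableT_comp => //.
  exact: measurable_funB.
have g0 z : (0 <= (fun z : R * R => (f (z.2 - z.1))%:E) z)%E by rewrite lee_fin.
have := markov_integral HX x0 s0 h0 As mg g0 => /= ->.
apply: (@le_trans _ _ (\int[P x]_(w in [set w | (X s w <= K)%R])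
   (h * (K * I + e))%:E)%E).
  apply: ge0_le_integral => //.
  - by move=> w _; apply: integral_ge0 => z _; rewrite lee_fin.
  - by apply: measurable_funTS; exact: (measurable_markov_integral HX s0 h0 mg g0).
  - move=> w /= wK; have w0 := CB_ge0 HX w s0.
    rewrite (le_trans (H _ _)) ?w0//= lee_fin mulrDr [e * h]mulrC lerD2r.
    by rewrite -mulrA ler_wpM2l// ler_wpM2r.
rewrite integral_cst// -[leRHS]mule1 lee_wpmul2l//.
  by rewrite lee_fin !(mulr_ge0, addr_ge0).
exact: probability_le1.
Qed.

(** Stands for the event that the path is bounded by [K] on [[0, t]]. Grid points make it a
    countable intersection, hence measurable, and taking all meshes at once makes it independent of
    [n] in the passage to the limit. *)
Definition grid_bounded t K : set T :=
  [set w | forall n k, (k <= n)%N -> X (k%:R * (t / n%:R)) w <= K].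

Lemma measurable_grid_bounded t K : 0 <= t -> measurable (grid_bounded t K).
Proof.
move=> t0; rewrite (_ : grid_bounded t K = \bigcap_n \bigcap_k
    [set w | (k <= n)%N -> X (k%:R * (t / n%:R)) w <= K]); last first.
  by apply/seteqP; split => [w H n _ k _|w H n k]; [exact: H|exact: (H n Logic.I k Logic.I)].
apply: bigcap_measurable => // n _; apply: bigcap_measurable => // k _.
have [kn|kn] := leqP k n; last first.
  rewrite (_ : mkset _ = setT)//; apply/seteqP; split => // w _ /=.
rewrite (_ : mkset _ = setT `&` X (k%:R * (t / n%:R)) @^-1` `]-oo, K]%classic); last first.
  by apply/seteqP; split => w /=; rewrite in_itv/=; [move=> /(_ isT)|case].
by apply: (measurable_X HX); rewrite ?mulr_ge0 ?invr_ge0.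
Qed.

Lemma bigcup_grid_bounded t : 0 < t ->
  \bigcup_(K : nat) grid_bounded t K%:R = setT.
Proof.
move=> t0; apply/seteqP; split => // w _.
have [B BP] := rcll_bounded t (CB_rcll HX w).
exists (Num.truncn B).+1 => // n k kn.
have tk : 0 <= k%:R * (t / n%:R) <= t.
  have t'0 := ltW t0; rewrite mulr_ge0 ?divr_ge0//=; case: n kn => [|n] kn.
    by rewrite invr0 !mulr0.
  by rewrite mulrCA ler_piMr// ler_pdivrMr// mul1r ler_nat.
rewrite (le_trans (ler_norm _))// (le_trans (BP _ tk))//.
by apply: ltW; exact: truncnS_gt.
Qed.

Lemma sup_jump_bump_upper x t K a b (f : R -> R) : 0 <= x -> 0 < t -> 0 <= K ->
  0 < a -> bump a b f ->
  (\int[P x]_(w in grid_bounded t K) (f (sup_jump (X ^~ w) t))%:E <=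
   (t * K)%:E * \int[pi]_r (f r)%:E)%E.
Proof.
move=> x0 t0 K0 a0 fP; have [cf f01 foff] := fP.
have f0 r : 0 <= f r by have /andP[] := f01 r.
have f00 : f 0 = 0 by apply: foff => /andP[? ?]; lra.
have mE : measurable (grid_bounded t K) by exact/measurable_grid_bounded/ltW.
rewrite (integral_levy_bump PhiP a0 fP).
set I := Rintegral _ _ _.
have I0 : 0 <= I by apply: Rintegral_ge0.
apply/lee_addgt0Pr => e e0; rewrite -EFinM -EFinD.
apply: cvge_to_le (integral_max_increment_cvg t0 mE cf f01) _.
(* There are [n] steps of length [t / n], each with error [(e / t) h], for a total of [e]. *)
have e'0 : 0 < e / t by rewrite divr_gt0.
have [h1 /andP[h10 h11] H1] := jump_rate PhiP HX a0 fP K0 e'0.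
near=> n.
have n0 : (0 < n)%N by near: n; exists 1%N.
have n0R : 0 < n%:R :> R by rewrite ltr0n.
set h := t / n%:R; have h0 : 0 <= h by rewrite divr_ge0// ltW.
have hh1 : h <= h1.
  rewrite ler_pdivrMr// -ler_pdivrMl// mulrC.
  by near: n; exact: nbhs_infty_ger.
have step y : 0 <= y <= K ->
    (\int[P y]_w (f (X h w - y))%:E <= (h * y * I + e / t * h)%:E)%E.
  move=> yK; rewrite -EFin_Rintegral//; last exact: (integrable_bump HX fP y h0).
  have := H1 h y; rewrite h0 hh1 => /(_ isT yK).
  by rewrite lee_fin ler_norml => /andP[_]; rewrite -/I; lra.
apply: (@le_trans _ _ (\sum_(k < n) \int[P x]_(w in grid_bounded t K)
    (f (X (k.+1%:R * h) w - X (k%:R * h) w)%R)%:E)%E).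
  have mfk k : measurable_fun setT (fun w => (f (X (k.+1%:R * h) w - X (k%:R * h) w)%R)%:E).
    apply/measurable_EFinP; apply: measurableT_comp.
      exact: continuous_measurable_fun.
    by apply: measurable_funB; apply: (measurable_X HX); rewrite mulr_ge0.
  rewrite -(@ge0_integral_sum _ _ _ (P x) _ mE 'I_n (fun k w =>
      (f (X (k.+1%:R * h) w - X (k%:R * h) w)%R)%:E)).
  - apply: ge0_le_integral => //.
    + by move=> w _; rewrite lee_fin.
    + apply/measurable_EFinP/measurable_funTS; apply: measurableT_comp.
        exact: continuous_measurable_fun.
      by apply: measurable_max_increment; exact: ltW.
    + by apply: emeasurable_sum => k; exact: measurable_funTS.
    + move=> w _; rewrite sumEFin lee_fin max_incrementE.
      exact: bigmax_le_sum.
  - by move=> k; exact: measurable_funTS.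
  - by move=> k w _; rewrite lee_fin.
apply: (@le_trans _ _ (\sum_(k < n) (h * (K * I + e / t))%:E)%E).
  apply: lee_sum => k _; have kh0 : 0 <= k%:R * h by rewrite mulr_ge0.
  have kS : k.+1%:R * h = k%:R * h + h by rewrite -[in LHS]natr1; ring.
  have := step_bump_upper x0 kh0 h0 K0 I0 (ltW e'0) f0 cf step.
  rewrite -kS; apply: le_trans; apply: ge0_subset_integral => //.
  - rewrite (_ : mkset _ = setT `&` X (k%:R * h) @^-1` `]-oo, K]%classic).
      exact: (measurable_X HX).
    by apply/seteqP; split => w /=; rewrite in_itv/=; [move=> ?|case].
  - apply/measurable_EFinP/measurable_funTS; apply: measurableT_comp.
      exact: continuous_measurable_fun.
    by apply: measurable_funB; apply: (measurable_X HX); rewrite mulr_ge0.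
  - by move=> w _; rewrite lee_fin.
  - by move=> w /= Hw; apply: Hw; exact: ltnW.
rewrite sumEFin lee_fin sumr_const card_ord -mulr_natl.
have -> : n%:R * (h * (K * I + e / t)) = t * K * I + e.
  by rewrite /h; field; rewrite !gt_eqF.
by [].
Unshelve. all: end_near. Qed.

(** Markov's inequality: on []a, b[] the integrand [min(theta, theta^2)] is at least
    [min(a, a^2) > 0]. *)
Lemma measure_open_itv_lty a b : 0 < a -> (pi `]a, b[%classic < +oo)%E.
Proof.
move=> a0; have [_ [_ levy] _ _] := PhiP.
pose m := Num.min a (a ^+ 2).
have m0 : 0 < m by rewrite lt_min a0 exprn_gt0.
have mmin : measurable_fun (setT : set R)
    (fun theta : R => (Num.min theta (theta ^+ 2))%:E).
  by apply/measurable_EFinP; apply: measurable_minr => //; exact: measurable_funX.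
have /le_lt_trans/(_ levy) :
    (m%:E * pi `]a, b[%classic <=
     \int[pi]_(theta in `]0%R, +oo[) (Num.min theta (theta ^+ 2))%:E)%E.
  rewrite -integral_cst//.
  apply: (@le_trans _ _ (\int[pi]_(theta in `]a, b[)
      (Num.min theta (theta ^+ 2))%:E)%E).
    apply: ge0_le_integral => //.
    - by move=> r _; rewrite lee_fin ltW.
    - exact: measurable_funTS.
    - move=> r /=; rewrite in_itv/= => /andP[ar _]; rewrite lee_fin /m.
      rewrite le_min !ge_min (ltW ar) /=; apply/orP; right.
      by rewrite lerXn2r ?nnegrE// ltW// (lt_trans a0).
  apply: ge0_subset_integral => //.
  - exact: measurable_funTS.
  - move=> r /=; rewrite in_itv/= andbT => r0.
    by rewrite lee_fin le_min (ltW r0) sqr_ge0.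
  - move=> r /=; rewrite !in_itv/= andbT => /andP[ar _].
    exact: lt_trans ar.
rewrite !ltey; apply: contra => /eqP ->; apply/eqP.
by rewrite gt0_muley// lte_fin.
Qed.

(** The constant [t K] in the bound is finite only for bounded paths, and test functions must vanish
    near 0 and near infinity. The event is therefore covered by countably many pieces indexed by [K]
    and by the intervals [D n m], each of them null. *)
Theorem sup_jump_dominated x t : 0 <= x -> 0 < t ->
  mrestr (pushforward (P x) (fun w => sup_jump (X ^~ w) t))
    (measurable_itv `]0, +oo[) `<< pi.
Proof.
move=> x0 t0 N0 N0null A mA AN; rewrite /mrestr /pushforward.
have piA : pi A = 0%E by exact: N0null.
have mS := measurable_sup_jump t0.
pose D n m : set R := `]n.+1%:R^-1, m%:R[%classic.
have mD n m : measurable (D n m) by exact: measurable_itv.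
have mE K := measurable_grid_bounded K (ltW t0).
have cover : (fun w => sup_jump (X ^~ w) t) @^-1` (A `&` `]0, +oo[%classic) `<=`
    \bigcup_n \bigcup_m \bigcup_(K : nat)
      (grid_bounded t K%:R `&` (fun w => sup_jump (X ^~ w) t) @^-1` (A `&` D n m)).
  move=> w [/= Aw]; rewrite in_itv/= andbT => S0.
  exists (Num.truncn (sup_jump (X ^~ w) t)^-1) => //.
  exists (Num.truncn (sup_jump (X ^~ w) t)).+1 => //.
  have : (\bigcup_(K : nat) grid_bounded t K%:R) w by rewrite bigcup_grid_bounded.
  case=> K _ HK; exists K => //; split => //; split => //.
  rewrite /D /= in_itv/= truncnS_gt andbT.
  by rewrite -[ltRHS]invrK ltf_pV2 ?posrE ?invr_gt0// truncnS_gt.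
have mpre n m (K : nat) : measurable (grid_bounded t K%:R `&`
    (fun w => sup_jump (X ^~ w) t) @^-1` (A `&` D n m)).
  apply: measurableI => //; rewrite -[X in measurable X]setTI; apply: mS => //.
  exact: measurableI.
have null n m (K : nat) : P x (grid_bounded t K%:R `&`
    (fun w => sup_jump (X ^~ w) t) @^-1` (A `&` D n m)) = 0%E.
  have n0 : 0 < n.+1%:R^-1 :> R by rewrite invr_gt0.
  rewrite -(image_measureE (P x) (mE K%:R) mS).
  apply: (@le_measure_continuous _ _ pi (D n m) (t * K%:R)).
  - by rewrite mulr_ge0// ltW.
  - exact: interval_open.
  - rewrite image_measureE (le_lt_trans (probability_le1 _ _)) ?ltry//.
    apply: measurableI => //; rewrite -[X in measurable X]setTI.
    exact: mS.
  - exact: measure_open_itv_lty.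
  - move=> f cf f01 foff; rewrite ge0_integral_image_measure.
    + apply: (@sup_jump_bump_upper _ _ _ n.+1%:R^-1 m%:R) => //; by split.
    + by apply/measurable_EFinP; exact: continuous_measurable_fun.
    + by move=> r; rewrite lee_fin; have /andP[] := f01 r.
  - exact: measurableI.
  - exact: subIsetr.
  - by apply: N0null; [exact: measurableI | apply: subset_trans AN; exact: subIsetl].
apply: measure_negligible.
  by rewrite -[X in measurable X]setTI; apply: mS => //; exact: measurableI.
apply: negligibleS cover _.
do 3 (apply: negligible_bigcup => ?).
by apply/negligibleP; [exact: mpre | exact: null].
Qed.

End sup_jump_law.

(** * Levy measure dominated by the law of the largest jump *)

(** As [t / N] tends to 0 the right-hand side tends to [exp (- x) - exp (- 2 x) > 0], and by
    continuity half of it survives. The resulting [N] fixes the initial stretch [t / N] of time on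
    which a jump is sought. *)
Lemma exp_weight_pick (R : realType) (C C2 x t : R) : 0 < x -> 0 < t ->
  exists2 N : nat, (0 < N)%N & t / N%:R <= 1 /\
    (expR (- x) - expR (- x * 2)) / 2 <=
    expR (- expR (C * (t / N%:R)) * x) - expR (- x * (2 - C2 * (t / N%:R))).
Proof.
move=> x0 t0.
pose g (u : R) := expR (- expR (C * u) * x) - expR (- x * (2 - C2 * u)).
have cg : continuous g.
  move=> u; apply: cvgB.
    apply: (@continuous_comp _ _ _ (fun u => - expR (C * u) * x) expR);
      last exact: continuous_expR.
    apply: cvgM; last exact: cvg_cst.
    apply: cvgN; apply: (@continuous_comp _ _ _ ( *%R C) expR);
      [exact: mulrl_continuous | exact: continuous_expR].
  apply: (@continuous_comp _ _ _ (fun u => - x * (2 - C2 * u)) expR);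
    last exact: continuous_expR.
  apply: cvgM; first exact: cvg_cst.
  by apply: cvgB; [exact: cvg_cst | exact: mulrl_continuous].
have g0E : g 0 = expR (- x) - expR (- x * 2).
  by rewrite /g !mulr0 expR0 subr0 mulN1r.
have g0 : 0 < g 0 by rewrite g0E subr_gt0 ltr_expR; lra.
have /cvgrPdist_le/(_ _ (divr_gt0 g0 (ltr0Sn R 1))) := cg 0.
move=> /nbhs_ballP[d /= d0 dP].
have m0 : 0 < Num.min 1 (d / 2) by rewrite lt_min ltr01 divr_gt0.
pose N := (Num.truncn (t / Num.min 1 (d / 2))).+1.
have N0 : 0 < N%:R :> R by rewrite ltr0n.
have tN : t / N%:R <= Num.min 1 (d / 2).
  rewrite ler_pdivrMr// -ler_pdivrMl// mulrC; apply: ltW; exact: truncnS_gt.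
have tN0 : 0 < t / N%:R by rewrite divr_gt0.
exists N => //; split; first by rewrite (le_trans tN)// ge_min lexx.
have := dP (t / N%:R); rewrite /ball /= sub0r normrN gtr0_norm// => /(_ _).
have : t / N%:R < d.
  have : Num.min 1 (d / 2) <= d / 2 by rewrite ge_min lexx orbT.
  lra.
move=> /[swap] /[apply]; rewrite -g0E -/(g _) ler_norml => /andP[_].
lra.
Qed.

Section sup_jump_lower.
Context (R : realType) (alpha beta : R)
  (pi : {sigma_finite_measure set R -> \bar R}) (Phi : R -> R)
  (d : measure_display)
  (T : measurableType d) (P : R -> probability T R) (X : R -> T -> R).
Hypothesis PhiP : is_branching_mechanism alpha beta pi Phi.
Hypothesis HX : CB_process Phi P X.
Implicit Types (x y s t h K L e a b c C : R) (i j k m n : nat).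

Let compound_bound C t h n : 0 <= C -> 0 <= h -> n%:R * h <= t ->
  (1 + C * h) ^+ n <= expR (C * t).
Proof.
move=> C0 h0 nh.
apply: (@le_trans _ _ (expR (C * h) ^+ n)).
  by rewrite lerXn2r ?nnegrE ?expR_ge0 ?addr_ge0 ?mulr_ge0// expR_ge1Dx.
by rewrite -expRM_natl ler_expR mulrCA ler_wpM2l.
Qed.

(** The killed Laplace functional with final exponent 1 is at most the wanted probability. At the
    start, where the state is at most [L], the weight is at least [exp (- M L) = 2 c]; the mesh is
    taken so fine that the accumulated error costs at most [c]. *)
Lemma no_large_increment a L t : 0 < a -> 0 <= L -> 0 < t ->
  exists2 c : R, 0 < c & exists2 h1 : R, 0 < h1 & forall x n j (B : set T),
    0 <= x -> (0 < n)%N -> (j <= n)%N -> t / n%:R <= h1 ->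
    natural_filtration X (j%:R * (t / n%:R)) B ->
    (forall w, B w -> X (j%:R * (t / n%:R)) w <= L) ->
    (c%:E * P x B <=
     P x (B `&` small_increments X a (t / n%:R) j n))%E.
Proof.
move=> a0 L0 t0; have [C C0 H0] := small_increment_laplace PhiP HX a0.
pose M := expR (C * t); have [C' C'0 H1] := H0 M.
pose c := expR (- M * L) / 2.
have c0 : 0 < c by rewrite divr_gt0 ?expR_gt0.
exists c => //; exists (Num.min 1 (c / (t * C' + 1))).
  rewrite lt_min ltr01 divr_gt0//.
  have : 0 <= t * C' by rewrite mulr_ge0// ltW.
  lra.
move=> x n j B x0 n0 jn; set h := t / n%:R; rewrite le_min => /andP[h1 hc] Bj BL.
have n0R : 0 < n%:R :> R by rewrite ltr0n.
have h0 : 0 <= h by rewrite divr_ge0 ?ltW.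
have h01 : 0 <= h <= 1 by rewrite h0.
have tC : 0 <= t * C' by rewrite mulr_ge0// ltW.
have hc' : t * C' * h <= c.
  by move: hc; rewrite ler_pdivlMr; [nra | lra].
have nh : n%:R * h = t by rewrite /h mulrC divfK// gt_eqF.
have mh : (n - j)%:R * h <= t by rewrite -nh ler_wpM2r// ler_nat leq_subr.
have powM : 1 * (1 + C * h) ^+ (n - j) <= M by rewrite mul1r compound_bound.
have mB := natural_filtration_measurable HX Bj.
have nh0 : 0 <= n%:R * h by rewrite mulr_ge0.
have jh0 : 0 <= j%:R * h by rewrite mulr_ge0.
have mS : measurable (small_increments X a h j n).
  by apply: (natural_filtration_measurable HX (s := n%:R * h));
    exact: natural_filtration_small.
have mBS : measurable (B `&` small_increments X a h j n) by exact: measurableI.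
have := small_increments_laplace HX x0 h01 C0 C'0 H1 Bj (lexx 1) powM.
rewrite subnKC//.
set lhs := (\int[P x]_(w in B) _)%E; set rhs := (\int[P x]_(w in _) _)%E => main.
have lhs_ge : ((expR (- M * L))%:E * P x B <= lhs)%E.
  rewrite -integral_cst//; apply: ge0_le_integral => //.
  - by move=> w _; rewrite lee_fin expR_ge0.
  - by apply/measurable_EFinP/measurable_funTS; exact: (measurable_X_exp HX).
  - move=> w Bw; rewrite lee_fin ler_expR !mulNr lerN2.
    have Xw := CB_ge0 HX w jh0.
    apply: (@le_trans _ _ (M * X (j%:R * h) w)); first by rewrite ler_wpM2r.
    by rewrite ler_wpM2l ?expR_ge0// BL.
have rhs_le : (rhs <= P x (B `&` small_increments X a h j n))%E.
  rewrite -[leRHS]mul1e -integral_cst//; apply: ge0_le_integral => //.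
  - by apply/measurable_EFinP/measurable_funTS; exact: (measurable_X_exp HX).
  - move=> w Bw; rewrite /= lee_fin -[leRHS]expR0 ler_expR mulN1r oppr_le0.
    exact: (CB_ge0 HX w nh0).
have {main} := le_trans lhs_ge (le_trans main (leeD2r _ rhs_le)).
have fin1 (D : set T) : measurable D -> P x D \is a fin_num.
  move=> mD; rewrite ge0_fin_numE//; apply: le_lt_trans (ltry 1).
  exact: probability_le1.
rewrite -(fineK (fin1 _ mB)) -(fineK (fin1 _ mBS)).
have pB0 : 0 <= fine (P x B) by rewrite fine_ge0.
set q := fine (P x (B `&` _)); set p := fine (P x B) in pB0 *.
rewrite -!EFinM -EFinD !lee_fin => main.
have err : (n - j)%:R * C' * h ^+ 2 <= c.
  apply: le_trans hc'.
  have -> : (n - j)%:R * C' * h ^+ 2 = ((n - j)%:R * h) * C' * h by ring.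
  by rewrite ler_wpM2r// ler_wpM2r.
have cE : expR (- M * L) = 2 * c by rewrite /c; field.
rewrite cE in main.
have : (n - j)%:R * C' * h ^+ 2 * p <= c * p by rewrite ler_wpM2r//.
lra.
Qed.

Lemma expR_pick (c : R) : 0 < c -> exists2 K : R, 0 <= K & expR (- K) <= c.
Proof.
move=> c0; exists (Num.max 0 (- ln c)); first by rewrite le_max lexx.
have E : expR (ln c) = c by rewrite lnK ?posrE.
by rewrite -[leRHS]E ler_expR lerNl le_max lexx orbT.
Qed.

Let cumulant0 (v : R -> R -> R) l : cumulant_semigroup Phi v -> 0 <= l -> v 0 l = l.
Proof.
move=> vP l0; have [C C0 CP] := cumulant_expansion PhiP vP l0.
have [+ _] := CP 0 (introT andP (conj (lexx 0) ler01)).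
by rewrite mulr0 normr_le0 subr_eq0 => /eqP.
Qed.

(* [X exp (- X)] is compared with [exp (- X) - exp (- 2 X)], whose first term is
   bounded below by the killed Laplace functional and whose second term is an
   honest Laplace transform. *)
Lemma weight_before_large_increment a x t : 0 < a -> 0 < x -> 0 < t ->
  exists2 c : R, 0 < c & exists2 K : R, 0 <= K & exists2 N : nat, (0 < N)%N &
  exists2 h1 : R, 0 < h1 & forall n k, (0 < n)%N -> (k * N <= n)%N ->
    t / n%:R <= h1 ->
    (c%:E <= \int[P x]_(w in small_increments X a (t / n%:R) 0 k `&`
       [set w | (X (k%:R * (t / n%:R)) w <= K)%R])
       (X (k%:R * (t / n%:R)) w)%R%:E)%E.
Proof.
move=> a0 x0 t0; have [C C0 H0] := small_increment_laplace PhiP HX a0.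
pose M := expR (C * t); have [C' C'0 H1] := H0 M.
have [v vP vE] := CB_laplace HX.
have l2 : 0 <= 2 :> R by [].
have [C2 C20 CP2] := cumulant_expansion PhiP vP l2.
(* Half of the gap [exp (- x) - exp (- 2 x)] is [4 c]. One [c] pays for the accumulated step errors
   and one for the truncation at [K], where [exp (- K) <= c]. *)
pose c := (expR (- x) - expR (- x * 2)) / 8.
have c0 : 0 < c by rewrite divr_gt0// subr_gt0 ltr_expR; lra.
have [K K0 Kc] := expR_pick c0.
have [N N0 [tN1 NP]] := exp_weight_pick C C2 x0 t0.
exists c => //; exists K => //; exists N => //.
exists (Num.min 1 (c / (t * C' + 1))).
  rewrite lt_min ltr01 divr_gt0//.
  have : 0 <= t * C' by rewrite mulr_ge0// ltW.
  lra.
move=> n k n0 kN; set h := t / n%:R; rewrite le_min => /andP[h1 hc].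
have n0R : 0 < n%:R :> R by rewrite ltr0n.
have N0R : 0 < N%:R :> R by rewrite ltr0n.
have h0 : 0 <= h by rewrite divr_ge0 ?ltW.
have h01 : 0 <= h <= 1 by rewrite h0.
have tC : 0 <= t * C' by rewrite mulr_ge0// ltW.
have hc' : t * C' * h <= c.
  by move: hc; rewrite ler_pdivlMr; [nra | lra].
have nh : n%:R * h = t by rewrite /h mulrC divfK// gt_eqF.
have kh0 : 0 <= k%:R * h by rewrite mulr_ge0.
have kh : k%:R * h <= t / N%:R.
  rewrite ler_pdivlMr// -nh mulrAC ler_wpM2r// -natrM ler_nat//.
have kht : k%:R * h <= t.
  rewrite (le_trans kh)// ler_pdivrMr//.
  by apply: ler_peMr; [exact: ltW | rewrite ler1n].
have kh1 : 0 <= k%:R * h <= 1 by rewrite kh0 (le_trans kh).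
have powM : 1 * (1 + C * h) ^+ k <= M by rewrite mul1r compound_bound.
have nfT : natural_filtration X (0%:R * h) setT by exact: natural_filtration_setT.
have := small_increments_laplace HX (ltW x0) h01 C0 C'0 H1 nfT (lexx 1) powM.
rewrite add0n setTI mul1r.
set A := small_increments X a h 0 k.
have nfA : natural_filtration X (k%:R * h) A by exact: natural_filtration_small.
have mA := natural_filtration_measurable HX nfA.
have mXk := measurable_X HX kh0.
have X0 w : 0 <= X (k%:R * h) w by exact: (CB_ge0 HX w kh0).
have start mu : 0 <= mu ->
    (\int[P x]_w (expR (- mu * X (0%:R * h) w))%:E = (expR (- mu * x))%:E)%E.
  move=> mu0; have := vE x 0 mu (ltW x0) (lexx 0) mu0.
  rewrite unlock mul0r (cumulant0 vP mu0) => ->.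
  by congr (expR _)%:E; ring.
rewrite start; last by rewrite exprn_ge0// addr_ge0// mulr_ge0.
rewrite [P x setT](_ : _ = 1%E); last exact: probability_setT.
rewrite mule1 => main.
have PT1 : P x setT = 1%E by exact: probability_setT.
pose e1 := expR (- expR (C * (t / N%:R)) * x).
have e1_le : e1 <= expR (- (1 + C * h) ^+ k * x).
  by rewrite ler_expR !mulNr lerN2 ler_pM2r// compound_bound.
have err : k%:R * C' * h ^+ 2 <= c.
  apply: le_trans hc'.
  have -> : k%:R * C' * h ^+ 2 = (k%:R * h) * C' * h by ring.
  by rewrite ler_wpM2r// ler_wpM2r.
pose e2 := expR (- x * (2 - C2 * (t / N%:R))).
have lap2 : (\int[P x]_(w in A) (expR (- 2 * X (k%:R * h) w))%:E <= e2%:E)%E.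
  apply: (@le_trans _ _ (\int[P x]_w (expR (- 2 * X (k%:R * h) w))%:E)%E).
    apply: ge0_subset_integral => //.
    by apply/measurable_EFinP; exact: (measurable_X_exp HX).
  have := vE x (k%:R * h) 2 (ltW x0) kh0 l2; rewrite unlock => ->.
  rewrite lee_fin ler_expR !mulNr lerN2 ler_pM2l//.
  have [+ _] := CP2 _ kh1; rewrite ler_norml => /andP[_].
  have : C2 * (k%:R * h) <= C2 * (t / N%:R) by rewrite ler_wpM2l.
  lra.
set W := (\int[P x]_(w in _) _)%E.
have W0 : (0 <= W)%E by apply: integral_ge0 => w _; rewrite lee_fin.
have mK : measurable [set w | X (k%:R * h) w <= K].
  rewrite (_ : mkset _ = setT `&` X (k%:R * h) @^-1` `]-oo, K]%classic).
    exact: mXk.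
  by apply/seteqP; split => w /=; rewrite in_itv/=; [move=> ?|case].
(* Pointwise, for [z >= 0], [exp (- z) - exp (- 2 z)] is at most [z], used when [z <= K], and at
   most [exp (- z) <= c] when [z > K]. *)
have split3 : (\int[P x]_(w in A) (expR (- 1 * X (k%:R * h) w))%:E <=
    e2%:E + W + c%:E)%E.
  pose g w := (if X (k%:R * h) w <= K then X (k%:R * h) w else 0) : R.
  have mg : measurable_fun setT g.
    apply: measurable_fun_ifT => //.
    by apply: measurable_fun_ler.
  have g0 w : 0 <= g w by rewrite /g; case: ifP.
  apply: (@le_trans _ _ (\int[P x]_(w in A)
      ((expR (- 2 * X (k%:R * h) w))%:E + (g w)%:E + c%:E))%E).
    apply: ge0_le_integral => //.
    - by apply/measurable_EFinP/measurable_funTS; exact: (measurable_X_exp HX).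
    - apply: emeasurable_funD => //; apply: emeasurable_funD => //.
        by apply/measurable_EFinP/measurable_funTS; exact: (measurable_X_exp HX).
      by apply/measurable_EFinP/measurable_funTS.
    - move=> w _; rewrite -!EFinD lee_fin /g; move: (X (k%:R * h) w) (X0 w) => z z0.
      rewrite mulN1r; have h3 := expR_gt0 (- z).
      have h4 : expR (- z) <= 1 by rewrite -expR0 ler_expR oppr_le0.
      have h5 := expR_ge1Dx (- z).
      have -> : expR (- 2 * z) = expR (- z) * expR (- z).
        by rewrite -expRD; congr expR; ring.
      case: ifPn => [_|]; first by nra.
      rewrite -ltNge => Kz.
      have : expR (- z) <= expR (- K) by rewrite ler_expR lerN2 ltW.
      nra.
  have m1 : measurable_fun A (fun w => (expR (- 2 * X (k%:R * h) w))%:E).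
    by apply/measurable_EFinP/measurable_funTS; exact: (measurable_X_exp HX).
  have m2 : measurable_fun A (fun w => (g w)%:E).
    by apply/measurable_EFinP/measurable_funTS.
  have p2 w : A w -> (0 <= (g w)%:E)%E by rewrite lee_fin.
  have p1 w : A w -> (0 <= (expR (- 2 * X (k%:R * h) w))%:E)%E.
    by rewrite lee_fin expR_ge0.
  have p12 w : A w -> (0 <= (expR (- 2 * X (k%:R * h) w))%:E + (g w)%:E)%E.
    by move=> Aw; rewrite adde_ge0 ?p1 ?p2.
  have m12 := emeasurable_funD m1 m2.
  have p3 (w : T) : A w -> (0 <= c%:E)%E by rewrite lee_fin ltW.
  rewrite (ge0_integralD _ mA p12 m12 p3)// (ge0_integralD _ mA p1 m1 p2 m2).
  apply: leeD; first apply: leeD => //.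
    rewrite le_eqVlt; apply/orP; left; apply/eqP; rewrite /W integral_mkcondr.
    apply: eq_integral => w _; rewrite /patch /g /=.
    have [zK|/negP zK] := boolP (X (k%:R * h) w <= K); first by rewrite mem_set.
    by rewrite memNset.
  rewrite integral_cst// -[leRHS]mule1; apply: lee_wpmul2l.
    by rewrite lee_fin ltW.
  exact: probability_le1.
have := le_trans main (leeD2r _ split3).
case: W W0 {split3 main} => [r| |] W0 final; [|exact: leey|by []].
move: final; rewrite -!EFinD !lee_fin; move: NP; rewrite -/e1 -/e2.
have -> : (expR (- x) - expR (- x * 2)) / 2 = 4 * c by rewrite /c; field.
lra.
Qed.

End sup_jump_lower.

Section sup_jump_dominates.
Context (R : realType) (alpha beta : R)
  (pi : {sigma_finite_measure set R -> \bar R}) (Phi : R -> R)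
  (d : measure_display)
  (T : measurableType d) (P : R -> probability T R) (X : R -> T -> R).
Hypothesis PhiP : is_branching_mechanism alpha beta pi Phi.
Hypothesis HX : CB_process Phi P X.
Implicit Types (x y s t h K L e a b c C : R) (i j k m n : nat).

(** Transfers the bound of [no_large_increment], an inequality between probabilities of events, to
    the integral of [f] of an increment, by comparing image measures. *)
Lemma le_integral_image (mu : {measure set T -> \bar R}) (B B' : set T)
    (Y : T -> R) (c : R) (f : R -> R) :
  0 <= c -> measurable B -> measurable B' -> measurable_fun setT Y ->
  measurable_fun setT f -> (forall r, 0 <= f r) ->
  (forall D, measurable D ->
    (c%:E * mu (B `&` Y @^-1` D) <= mu (B' `&` Y @^-1` D))%E) ->
  (c%:E * \int[mu]_(w in B) (f (Y w))%:E <= \int[mu]_(w in B') (f (Y w))%:E)%E.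
Proof.
move=> c0 mB mB' mY mf f0 H.
have mEf : measurable_fun setT (fun r => (f r)%:E) by exact/measurable_EFinP.
have Ef0 r : (0 <= (f r)%:E)%E by rewrite lee_fin.
rewrite -(ge0_integral_image_measure mu mB mY mEf Ef0).
rewrite -(ge0_integral_image_measure mu mB' mY mEf Ef0).
have cE : c = (NngNum c0)%:num by [].
rewrite {1}cE -ge0_integral_mscale//.
apply: ge0_le_measure_integral => // D mD.
rewrite image_measureE; apply: le_trans (H D mD).
by rewrite /= /mscale /=  image_measureE.
Qed.

Lemma step_bump_lower x s h I e K A (f : R -> R) : 0 <= x -> 0 <= s -> 0 <= h ->
  0 <= I -> 0 <= e -> (forall r, 0 <= f r) -> continuous f ->
  (forall y, (0 <= y <= K)%R ->
    (h * y * I)%R%:E <= \int[P y]_w (f (X h w - y)%R)%:E + (e * h)%R%:E)%E ->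
  natural_filtration X s A -> (forall w, A w -> X s w <= K) ->
  ((h * I)%R%:E * \int[P x]_(w in A) (X s w)%:E
    <= \int[P x]_(w in A) (f (X (s + h) w - X s w)%R)%:E + (e * h)%R%:E)%E.
Proof.
move=> x0 s0 h0 I0 e0 f0 cf H As AK; have mf := continuous_measurable_fun cf.
have mA := natural_filtration_measurable HX As.
have mg : measurable_fun setT (fun z : R * R => (f (z.2 - z.1))%:E).
  apply/measurable_EFinP; apply: measurableT_comp => //.
  exact: measurable_funB.
have g0 z : (0 <= (fun z : R * R => (f (z.2 - z.1))%:E) z)%E by rewrite lee_fin.
have := markov_integral HX x0 s0 h0 As mg g0 => /= ->.
have mX : measurable_fun A (fun w => (X s w)%:E).
  by apply/measurable_EFinP/measurable_funTS; exact: (measurable_X HX).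
have X0 w : 0 <= X s w by exact: (CB_ge0 HX w s0).
rewrite -ge0_integralZl//; last 2 first.
- by move=> w _; rewrite lee_fin.
- by rewrite lee_fin mulr_ge0.
have mG := measurable_markov_integral HX s0 h0 mg g0.
have eh0 : 0 <= e * h by rewrite mulr_ge0.
apply: (@le_trans _ _ (\int[P x]_(w in A)
   (\int[P (X s w)]_z (f (X h z - X s w))%:E + (e * h)%:E))%E).
  apply: ge0_le_integral => //.
  - by move=> w _; rewrite -EFinM lee_fin !mulr_ge0.
  - exact: measurable_funeM.
  - by apply: emeasurable_funD => //; exact: measurable_funTS.
  - move=> w Aw; rewrite -EFinM mulrAC; apply: H.
    by rewrite X0 AK.
have G0 w : A w -> (0 <= \int[P (X s w)]_z (f (X h z - X s w))%:E)%E.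
  by move=> _; apply: integral_ge0 => z _; rewrite lee_fin.
rewrite (ge0_integralD _ mA G0 (measurable_funTS mG))//.
rewrite leeD2l// integral_cst// -[leRHS]mule1 lee_wpmul2l ?lee_fin//.
exact: probability_le1.
Qed.

(** Only steps before time [delta = t / N] are used. Each contributes about [h I] times the mean
    state [c2] for an increment in []a, b[], times [c1] for the absence of later large increments.
    Summing [m] steps with [m h = delta] gives the constant. *)
Lemma sup_jump_bump_lower a b x t : 0 < a -> 0 < b -> 0 < x -> 0 < t ->
  exists2 c : R, 0 < c & forall f : R -> R, bump a b f ->
    (c%:E * \int[pi]_r (f r)%:E <=
     \int[P x]_w (f (sup_jump (X ^~ w) t))%:E)%E.
Proof.
move=> a0 b0 x0 t0.
have [c2 c20 [K K0 [N N0 [h2 h20 H2]]]] :=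
  weight_before_large_increment PhiP HX a0 x0 t0.
(* Level reached after the chosen step: at most [K] before it, plus an increment below [b]. *)
have L0 : 0 <= K + b by rewrite addr_ge0// ltW.
have [c1 c10 [h3 h30 H3]] := no_large_increment PhiP HX a0 L0 t0.
have N0R : 0 < N%:R :> R by rewrite ltr0n.
pose delta := t / N%:R; have delta0 : 0 < delta by rewrite divr_gt0.
exists (c1 * delta * c2); first exact: mulr_gt0 (mulr_gt0 c10 delta0) c20.
move=> f fP; have [cf f01 foff] := fP.
have f0 r : 0 <= f r by have /andP[] := f01 r.
have mf := continuous_measurable_fun cf.
rewrite (integral_levy_bump PhiP a0 fP).
set I := Rintegral _ _ _.
have I0 : 0 <= I by apply: Rintegral_ge0.
apply/lee_addgt0Pr => e e0.
(* Each of the [m] steps loses [c1 e' h], and [m h = delta], so the total loss is [e]. *)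
pose e' := e / (c1 * delta).
have e'0 : 0 < e' by rewrite divr_gt0// mulr_gt0.
have [h1 /andP[h10 h11] H1] := jump_rate PhiP HX a0 fP K0 e'0.
rewrite -EFinM -leeBlDr// -EFinB.
(* Along the subsequence [n = N m], the first [m] steps fill [[0, delta]] exactly. *)
have sub : (fun m => (N * m)%N) m @[m --> \oo] --> \oo.
  move=> U [M _ MU]; exists M => // m /= Mm; apply: MU => /=.
  by rewrite (leq_trans Mm)// leq_pmull.
have cvgS := integral_max_increment_cvg (x := x) HX t0 measurableT cf f01.
apply: cvge_to_ge (cvg_comp _ _ sub cvgS) _.
near=> m => /=.
have m0 : (0 < m)%N by near: m; exact: nbhs_infty_gt.
have m0R : 0 < m%:R :> R by rewrite ltr0n.
set n := (N * m)%N; have n0 : (0 < n)%N by rewrite muln_gt0 N0.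
have n0R : 0 < n%:R :> R by rewrite ltr0n.
set h := t / n%:R; have h0 : 0 <= h by rewrite divr_ge0// ltW.
have hE : h = delta / m%:R.
  by rewrite /h /delta /n natrM; field; rewrite !gt_eqF.
have [hh1 hh2 hh3] : [/\ h <= h1, h <= h2 & h <= h3].
  have small (h' : R) : 0 < h' -> delta / h' <= m%:R -> h <= h'.
    by move=> h'0 hm; rewrite hE ler_pdivrMr// -ler_pdivrMl// mulrC.
  split; apply: small => //; near: m; exact: nbhs_infty_ger.
pose xi k w := X (k.+1%:R * h) w - X (k%:R * h) w.
pose A k := small_increments X a h 0 k `&` [set w | X (k%:R * h) w <= K].
pose B k := A k `&` [set w | a < xi k w < b].
pose G k := B k `&` small_increments X a h k.+1 n.
have kh0 k : 0 <= k%:R * h by rewrite mulr_ge0.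
have khS k : k.+1%:R * h = k%:R * h + h by rewrite -[in LHS]natr1; ring.
have mxi k : measurable_fun setT (xi k).
  by apply: measurable_funB; exact: (measurable_X HX).
have nfA k : natural_filtration X (k%:R * h) (A k).
  apply: natural_filtrationI; first exact: natural_filtration_small.
  rewrite (_ : mkset _ = X (k%:R * h) @^-1` `]-oo, K]%classic).
    by apply: natural_filtration_preimage => //; rewrite kh0 lexx.
  by apply/seteqP; split => w /=; rewrite in_itv.
have nfxi k (D : set R) : measurable D ->
    natural_filtration X (k.+1%:R * h) (xi k @^-1` D).
  move=> mD; apply: natural_filtration_increment => //; rewrite kh0//=.
  by rewrite khS lerDl.
have nfA' k : natural_filtration X (k.+1%:R * h) (A k).
  by apply: natural_filtration_le (nfA k); rewrite khS lerDl.
have nfB k : natural_filtration X (k.+1%:R * h) (B k).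
  apply: natural_filtrationI => //.
  rewrite (_ : mkset _ = xi k @^-1` `]a, b[%classic); first exact: nfxi.
  by apply/seteqP; split => w /=; rewrite in_itv.
have mA k := natural_filtration_measurable HX (nfA k).
have mB k := natural_filtration_measurable HX (nfB k).
have mG k : (k < n)%N -> measurable (G k).
  move=> kn; apply: measurableI => //.
  by apply: (natural_filtration_measurable HX (s := n%:R * h));
    exact: natural_filtration_small.
have mfxi k : measurable_fun setT (fun w => (f (xi k w))%:E).
  by apply/measurable_EFinP; apply: measurableT_comp.
have step k : (k < m)%N -> ((c1 * (h * I * c2 - e' * h))%:E <=
    \int[P x]_(w in G k) (f (xi k w))%:E)%E.
  move=> km; have kn : (k < n)%N by rewrite (leq_trans km)// leq_pmull.
  have kN : (k * N <= n)%N by rewrite mulnC leq_mul2l (ltnW km) orbT.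
  have := H2 n k n0 kN hh2; rewrite -/h -/(A k) => W.
  have one y : 0 <= y <= K ->
      ((h * y * I)%:E <= \int[P y]_w (f (X h w - y))%:E + (e' * h)%:E)%E.
    move=> yK; rewrite -EFin_Rintegral//; last exact: (integrable_bump HX fP y h0).
    have := H1 h y; rewrite h0 hh1 => /(_ isT yK).
    by rewrite -EFinD lee_fin ler_norml => /andP[+ _]; rewrite -/I; lra.
  have AK w : A k w -> X (k%:R * h) w <= K by case.
  have := step_bump_lower (ltW x0) (kh0 k) h0 I0 (ltW e'0) f0 cf one (nfA k) AK.
  rewrite -khS -/(xi k _) => lowA.
  have ABE : (\int[P x]_(w in A k) (f (xi k w))%:E =
      \int[P x]_(w in B k) (f (xi k w))%:E)%E.
    rewrite [RHS]integral_mkcondr; apply: eq_integral => w _.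
    rewrite /patch; case: ifPn => //; rewrite notin_setE /= => ab.
    by rewrite foff.
  have lowB : (c1%:E * \int[P x]_(w in B k) (f (xi k w))%:E <=
      \int[P x]_(w in G k) (f (xi k w))%:E)%E.
    (* Restricting [B k] further to [xi k] in [D] keeps it known at time [(k + 1) h], so
       [no_large_increment] applies with the same constant for every [D]. *)
    apply: le_integral_image => //; [exact: ltW | exact: mG | move=> D mD].
    have := H3 x n k.+1 (B k `&` xi k @^-1` D) (ltW x0) n0 kn hh3.
    rewrite -/h setIAC -/(G k); apply.
      by apply: natural_filtrationI => //; exact: nfxi.
    move=> w [[[_ /= XK] /andP[_ xib]] _].
    by rewrite -(subrK (X (k%:R * h) w) (X _ w)) addrC; apply: lerD => //; exact: ltW.
  have {}W : ((h * I * c2)%:E <=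
      (h * I)%:E * \int[P x]_(w in A k) (X (k%:R * h) w)%:E)%E.
    by rewrite EFinM lee_wpmul2l// lee_fin mulr_ge0.
  apply: le_trans lowB; rewrite EFinM.
  apply: lee_wpmul2l; first by rewrite lee_fin ltW.
  by rewrite -ABE EFinB leeBlDr//; exact: le_trans W lowA.
(* On [G k] the increment [xi k] is the only one above [a], hence it is the maximum. For the same
   reason the events [G k] are disjoint, and at most one term of the sum is nonzero. *)
have pointwise w : (\sum_(k < m) (f (xi k w) * \1_(G k) w) <=
    f (max_increment (X ^~ w) t n)).
  have [[k Gk]|noG] := pselect (exists k : 'I_m, G k w); last first.
    rewrite big1// => k _; rewrite indicE memNset ?mulr0// => Gk.
    by apply: noG; exists k.
  have kn : (k < n)%N by rewrite (leq_trans (ltn_ord k))// leq_pmull.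
  have [[[before _] /andP[axi xib]] after] := Gk.
  have others j : (j < n)%N -> j != k -> xi j w <= a.
    move=> jn; rewrite neq_ltn => /orP[jk|kj]; first exact: before.
    by apply: after; rewrite kj.
  have -> : max_increment (X ^~ w) t n = xi k w.
    rewrite max_incrementE; apply/eqP; rewrite eq_le; apply/andP; split.
      apply: bigmax_le => [|j _]; first by rewrite ltW// (lt_trans a0).
      have [->//|jk] := eqVneq (j : nat) k.
      by rewrite (le_trans (others j (ltn_ord j) jk))// ltW.
    exact: (@le_bigmax _ _ _ 0 _ (Ordinal kn)).
  rewrite (bigD1 k)//= big1 ?addr0.
    by rewrite indicE mem_set// mulr1.
  move=> j jk; rewrite indicE memNset ?mulr0// => -[[_ /andP[axj _]] _].
  have jn : (j < n)%N by rewrite (leq_trans (ltn_ord j))// leq_pmull.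
  by have := others j jn jk; rewrite leNgt axj.
apply: (@le_trans _ _ (\sum_(k < m) \int[P x]_(w in G k) (f (xi k w))%:E)%E).
  apply: (@le_trans _ _ (\sum_(k < m) (c1 * (h * I * c2 - e' * h))%:E)%E).
    rewrite sumEFin lee_fin sumr_const card_ord -mulr_natl.
    have -> : m%:R * (c1 * (h * I * c2 - e' * h)) = c1 * delta * c2 * I - e.
      by rewrite hE /e'; field; rewrite !gt_eqF.
    by [].
  by apply: lee_sum => k _; exact: step.
have mind k : (k < m)%N ->
    measurable_fun setT (fun w => (f (xi k w) * \1_(G k) w)%:E).
  move=> km; apply/measurable_EFinP; apply: measurable_funM.
    by apply: measurableT_comp.
  apply: measurable_indic; apply: mG.
  by rewrite (leq_trans km)// leq_pmull.
rewrite (eq_bigr (fun k : 'I_m =>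
    \int[P x]_w (f (xi k w) * \1_(G k) w)%:E)%E); last first.
  move=> k _; rewrite integral_mkcond; apply: eq_integral => w _.
  rewrite /patch indicE; case: ifPn => _; first by rewrite mulr1.
  by rewrite mulr0.
rewrite -(@ge0_integral_sum _ _ _ (P x) _ measurableT 'I_m (fun (k : 'I_m) w =>
    (f (xi k w) * \1_(G k) w)%:E)).
- apply: ge0_le_integral => //.
  + by move=> w _; apply: sume_ge0 => k _; rewrite lee_fin mulr_ge0.
  + by apply: emeasurable_sum => k; exact: mind.
  + apply/measurable_EFinP; apply: measurableT_comp => //.
    by apply: (measurable_max_increment HX); exact: ltW.
  + by move=> w _; rewrite sumEFin lee_fin.
- by move=> k; exact: mind.
- by move=> k w _; rewrite lee_fin mulr_ge0.
Unshelve. all: end_near. Qed.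

(** On each [D n m] the lower bound holds with a constant common to all test functions supported
    there, so [le_measure_continuous] applies with its inverse. What [A] has outside []0, +oo[] is
    not charged by [pi]. *)
Lemma sup_jump_dominates x t : 0 < x -> 0 < t ->
  pi `<< mrestr (pushforward (P x) (fun w => sup_jump (X ^~ w) t))
    (measurable_itv `]0, +oo[).
Proof.
move=> x0 t0 N0 N0null A mA AN.
have [_ [pi0 _] _ _] := PhiP.
have mS := measurable_sup_jump HX t0.
pose D n m : set R := `]n.+1%:R^-1, m.+1%:R[%classic.
have mD n m : measurable (D n m) by exact: measurable_itv.
have cover : A `<=` ~` `]0, +oo[%classic `|` \bigcup_n \bigcup_m (A `&` D n m).
  move=> r Ar; have [r0|r0] := ltP 0 r; last first.
    by left; rewrite /= in_itv/= andbT; apply/negP; rewrite -leNgt.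
  right; exists (Num.truncn r^-1) => //; exists (Num.truncn r) => //; split => //.
  rewrite /D /= in_itv/= truncnS_gt andbT.
  by rewrite -[ltRHS]invrK ltf_pV2 ?posrE ?invr_gt0// truncnS_gt.
have null n m : pi (A `&` D n m) = 0%E.
  have n0 : 0 < n.+1%:R^-1 :> R by rewrite invr_gt0.
  have m0 : 0 < m.+1%:R :> R by rewrite ltr0n.
  have [c c0 cP] := sup_jump_bump_lower n0 m0 x0 t0.
  apply: (@le_measure_continuous _ pi (image_measure (P x) measurableT mS)
    (D n m) c^-1).
  - by rewrite invr_ge0 ltW.
  - exact: interval_open.
  - exact: (measure_open_itv_lty PhiP).
  - rewrite image_measureE setTI (le_lt_trans (probability_le1 _ _)) ?ltry//.
    rewrite -[X in measurable X]setTI.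
    exact: mS.
  - move=> f cf f01 foff; rewrite ge0_integral_image_measure.
    + rewrite -lee_pdivrMl ?invr_gt0// invrK; apply: cP; by split.
    + by apply/measurable_EFinP; exact: continuous_measurable_fun.
    + by move=> r; rewrite lee_fin; have /andP[] := f01 r.
  - exact: measurableI.
  - exact: subIsetr.
  - rewrite image_measureE setTI.
    have mAD : measurable (A `&` D n m) by exact: measurableI.
    have := N0null _ mAD (subset_trans (@subIsetl _ A (D n m)) AN).
    rewrite /mrestr /pushforward setIidl// => r [_].
    rewrite /D /= !in_itv/= andbT => /andP[h _]; exact: lt_trans h.
apply: measure_negligible => //; apply: negligibleS cover _.
apply: negligibleU.
  apply/negligibleP => //; apply: measurableC; exact: measurable_itv.
do 2 (apply: negligible_bigcup => ?).
by apply/negligibleP; [exact: measurableI | exact: null].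
Qed.

End sup_jump_dominates.

Theorem theorem3p14 (R : realType) (alpha beta : R)
    (pi : {sigma_finite_measure set R -> \bar R}) (Phi : R -> R)
    (d : measure_display) (T : measurableType d)
    (P : R -> probability T R) (X : R -> T -> R) (x t : R) :
  is_branching_mechanism alpha beta pi Phi ->
  pi setT != 0%E ->
  CB_process Phi P X ->
  0 < x ->
  0 < t ->
  mutually_absolutely_continuous
    (mrestr (pushforward (P x) (fun w => sup_jump (X ^~ w) t))
       (measurable_itv `]0, +oo[))
    pi.
Proof.
move=> PhiP _ HX x0 t0; split.
  exact: (sup_jump_dominated PhiP HX (ltW x0) t0).
exact: (sup_jump_dominates PhiP HX x0 t0).
Qed.
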